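(* Let $\mathcal{A}$ be an abelian category with subcategories $\mathcal{W}\subseteq\mathcal{X}$ and $\mathcal{V}\subseteq\mathcal{Y}$ such that $\mathcal{X}\perp\mathcal{W}$ and $\mathcal{V}\perp\mathcal{Y}$. Let $\mathcal{P}$ and $\mathcal{I}$ be the subcategories of projective and injective objects of $\mathcal{A}$, and let $M$ and $N$ be objects in $\mathcal{A}$. (a) If $M$ is in $\operatorname{res}\widetilde{\mathcal{X}}\cap\operatorname{res}\widetilde{\mathcal{P}}$ and $N$ is in $\operatorname{res}\widehat{\mathcal{W}}$, then the natural map $\varkappa^n_{\mathcal{X}\mathcal{A}}(M,N)\colon\operatorname{Ext}^n_{\mathcal{X}\mathcal{A}}(M,N)\to\operatorname{Ext}^n_{\mathcal{A}}(M,N)$ is an isomorphism for each $n$. (b) If $M$ is in $\operatorname{cores}\widehat{\mathcal{V}}$ and $N$ is in $\operatorname{cores}\widetilde{\mathcal{Y}}\cap\operatorname{cores}\widetilde{\mathcal{I}}$, then the natural map $\varkappa^n_{\mathcal{A}\mathcal{Y}}(M,N)\colon\operatorname{Ext}^n_{\mathcal{A}\mathcal{Y}}(M,N)\to\operatorname{Ext}^n_{\mathcal{A}}(M,N)$ is an isomorphism for each $n$.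
   Context: ''Subcategory'' means full, additive subcategory closed under isomorphisms. For classes $\mathcal{C},\mathcal{D}$ of objects, $\mathcal{C}\perp\mathcal{D}$ means $\operatorname{Ext}^i_{\mathcal{A}}(C,D)=0$ for all $i\geq1$, $C\in\mathcal{C}$, $D\in\mathcal{D}$. Complexes are indexed homologically. For a subcategory $\mathcal{C}$, a $\mathcal{C}$-resolution of $M$ is a complex $C$ of objects of $\mathcal{C}$ with $C_n=0$ for $n<0$, $\operatorname{H}_n(C)=0$ for $n>0$ and $\operatorname{H}_0(C)\cong M$; its augmented resolution is $C^+=\cdots\to C_1\to C_0\to M\to0$. It is proper if $\operatorname{Hom}_{\mathcal{A}}(C',C^+)$ is exact for every $C'\in\mathcal{C}$. $\operatorname{res}\widehat{\mathcal{C}}$ (resp. $\operatorname{res}\widetilde{\mathcal{C}}$) is the subcategory of objects having a bounded (resp. proper) $\mathcal{C}$-resolution. Dually, a $\mathcal{C}$-coresolution of $N$ is a complex $C$ of objects of $\mathcal{C}$ with $C_n=0$ for $n>0$, $\operatorname{H}_n(C)=0$ for $n<0$ and $\operatorname{H}_0(C)\cong N$, with augmented coresolution ${}^+C=0\to N\to C_0\to C_{-1}\to\cdots$; it is proper if $\operatorname{Hom}_{\mathcal{A}}({}^+C,C')$ is exact for every $C'\in\mathcal{C}$. $\operatorname{cores}\widehat{\mathcal{C}}$ (resp. $\operatorname{cores}\widetilde{\mathcal{C}}$) is the subcategory of objects having a bounded (resp. proper) $\mathcal{C}$-coresolution. (Projective resolutions are always $\mathcal{P}$-proper and injective coresolutions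 always $\mathcal{I}$-proper, so $\operatorname{res}\widetilde{\mathcal{P}}$, $\operatorname{cores}\widetilde{\mathcal{I}}$ consist of the objects having a projective resolution, resp. an injective resolution.) If $M$ has a proper $\mathcal{X}$-resolution $X\to M$, then $\operatorname{Ext}^n_{\mathcal{X}\mathcal{A}}(M,N)=\operatorname{H}_{-n}(\operatorname{Hom}_{\mathcal{A}}(X,N))$. If $N$ has a proper $\mathcal{Y}$-coresolution $N\to Y$, then $\operatorname{Ext}^n_{\mathcal{A}\mathcal{Y}}(M,N)=\operatorname{H}_{-n}(\operatorname{Hom}_{\mathcal{A}}(M,Y))$. These are independent of choices. Comparison maps: if $M$ has a projective resolution $\gamma\colon P\to M$ and a proper $\mathcal{X}$-resolution $\gamma'\colon X\to M$, there is a morphism $\widetilde{\operatorname{id}_M}\colon P\to X$, unique up to homotopy (and a quasiisomorphism), with $\gamma=\gamma'\,\widetilde{\operatorname{id}_M}$; then $\varkappa^n_{\mathcal{X}\mathcal{A}}(M,N)=\operatorname{H}_{-n}(\operatorname{Hom}_{\mathcal{A}}(\widetilde{\operatorname{id}_M},N))$. If $N$ has a proper $\mathcal{Y}$-coresolution $\delta\colon N\to Y$ and an injective resolution $\delta'\colon N\to I$, there is a morphism $\widetilde{\operatorname{id}_N}\colon Y\to I$, unique up to homotopy (and a quasiisomorphism), with $\delta'=\widetilde{\operatorname{id}_N}\,\delta$; then $\varkappa^n_{\mathcal{A}\mathcal{Y}}(M,N)=\operatorname{H}_{-n}(\operatorname{Hom}_{\mathcal{A}}(M,\widetilde{\operatorname{id}_N}))$.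 *)

(* Defs.v *)
From HB Require Import structures.
From mathcomp Require Import all_boot all_order all_algebra zify.
From mathcomp Require Import boolp.
From Stdlib Require Import Relation_Operators.

Set Implicit Arguments.
Unset Strict Implicit.
Unset Printing Implicit Defensive.

Import Order.TTheory GRing.Theory Num.Theory.
Local Open Scope ring_scope.

(** * Abelian categories *)

Record preadditive := Preadditive {
  ob :> Type;
  hom : ob -> ob -> zmodType;
  idm : forall a, hom a a;
  comp : forall a b c, hom b c -> hom a b -> hom a c;
  compA : forall a b c d (h : hom c d) (g : hom b c) (f : hom a b),
    comp h (comp g f) = comp (comp h g) f;
  comp1m : forall a b (f : hom a b), comp (idm b) f = f;
  compm1 : forall a b (f : hom a b), comp f (idm a) = f;
  compDl : forall a b c (g g' : hom b c) (f : hom a b),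
    comp (g + g') f = comp g f + comp g' f;
  compDr : forall a b c (g : hom b c) (f f' : hom a b),
    comp g (f + f') = comp g f + comp g f'
}.

Arguments idm {p} a.

Declare Scope cat_scope.
Delimit Scope cat_scope with cat.
Local Open Scope cat_scope.
Notation "g \o f" := (comp g f) : cat_scope.

Section Preadditive.
Variable A : preadditive.
Implicit Types a b c k s : A.

Lemma comp0m a b c (f : hom a b) : (0 : hom b c) \o f = 0.
Proof. by apply: (addIr ((0 : hom b c) \o f)); rewrite -compDl !add0r. Qed.

Lemma compm0 a b c (g : hom b c) : g \o (0 : hom a b) = 0.
Proof. by apply: (addIr (g \o (0 : hom a b))); rewrite -compDr !add0r. Qed.

Lemma compBl a b c (g g' : hom b c) (f : hom a b) :
  (g - g') \o f = (g \o f) - (g' \o f).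
Proof. by apply/eqP; rewrite eq_sym subr_eq -compDl subrK. Qed.

Lemma compBr a b c (g : hom b c) (f f' : hom a b) :
  g \o (f - f') = (g \o f) - (g \o f').
Proof. by apply/eqP; rewrite eq_sym subr_eq -compDr subrK. Qed.

Definition mono a b (f : hom a b) : Prop :=
  forall c (g h : hom c a), f \o g = f \o h -> g = h.

Definition epi a b (f : hom a b) : Prop :=
  forall c (g h : hom b c), g \o f = h \o f -> g = h.

Definition is_iso a b (f : hom a b) : Prop :=
  exists g : hom b a, g \o f = idm a /\ f \o g = idm b.

Definition is_zero a : Prop :=
  forall b, (forall f : hom a b, f = 0) /\ (forall f : hom b a, f = 0).

Definition is_kernel k a b (i : hom k a) (f : hom a b) : Prop :=
  [/\ f \o i = 0, mono i
    & forall c (g : hom c a), f \o g = 0 -> exists h : hom c k, i \o h = g].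

Definition is_cokernel c a b (p : hom b c) (f : hom a b) : Prop :=
  [/\ p \o f = 0, epi p
    & forall d (g : hom b d), g \o f = 0 -> exists h : hom c d, h \o p = g].

Definition is_biproduct s a b : Prop :=
  exists (i : hom a s) (j : hom b s) (p : hom s a) (q : hom s b),
    [/\ p \o i = idm a, q \o j = idm b, q \o i = 0, p \o j = 0
      & (i \o p) + (j \o q) = idm s].

Record abelian : Prop := Abelian {
  has_zero : exists a, is_zero a;
  has_biproduct : forall a b, exists s, is_biproduct s a b;
  has_kernel : forall a b (f : hom a b), exists k (i : hom k a), is_kernel i f;
  has_cokernel : forall a b (f : hom a b),
    exists c (p : hom b c), is_cokernel p f;
  mono_normal : forall a b (f : hom a b), mono f ->
    exists c (g : hom b c), is_kernel f g;
  epi_normal : forall a b (f : hom a b), epi f ->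
    exists c (g : hom c a), is_cokernel f g
}.

End Preadditive.

Record abelianCat := AbelianCat {
  base :> preadditive;
  abelianP : abelian base
}.

Section Choices.
Variable A : abelianCat.
Implicit Types a b c : A.

Definition zob : A := sval (cid (has_zero (abelianP A))).

Lemma zobP : is_zero zob. Proof. by rewrite /zob; case: cid. Qed.

Section Kernel.
Variables (a b : A) (f : hom a b).

Fact kerdata : {k : A & {i : hom k a | is_kernel i f}}.
Proof. by have /cid[k /cid ki] := has_kernel (abelianP A) f; exists k. Qed.

Definition kerob : A := projT1 kerdata.
Definition kermap : hom kerob a := sval (projT2 kerdata).

Lemma kermapP : is_kernel kermap f. Proof. exact: svalP (projT2 kerdata). Qed.

Fact kerlift_subproof c (g : hom c a) (fg0 : f \o g = 0) :
  exists h : hom c kerob, kermap \o h = g.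
Proof. by have [_ _] := kermapP; apply. Qed.

Definition kerlift c (g : hom c a) (fg0 : f \o g = 0) : hom c kerob :=
  sval (cid (kerlift_subproof fg0)).

Lemma kerliftK c (g : hom c a) (fg0 : f \o g = 0) : kermap \o kerlift fg0 = g.
Proof. by rewrite /kerlift; case: cid. Qed.

Fact cokdata : {c : A & {p : hom b c | is_cokernel p f}}.
Proof. by have /cid[c /cid cp] := has_cokernel (abelianP A) f; exists c. Qed.

Definition cokob : A := projT1 cokdata.
Definition cokmap : hom b cokob := sval (projT2 cokdata).

Lemma cokmapP : is_cokernel cokmap f. Proof. exact: svalP (projT2 cokdata). Qed.

Fact cokdesc_subproof c (g : hom b c) (gf0 : g \o f = 0) :
  exists h : hom cokob c, h \o cokmap = g.
Proof. by have [_ _] := cokmapP; apply. Qed.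

Definition cokdesc c (g : hom b c) (gf0 : g \o f = 0) : hom cokob c :=
  sval (cid (cokdesc_subproof gf0)).

Lemma cokdescK c (g : hom b c) (gf0 : g \o f = 0) : cokdesc gf0 \o cokmap = g.
Proof. by rewrite /cokdesc; case: cid. Qed.

End Kernel.
End Choices.

(** * Subcategories *)

(* A full subcategory is given by its class of objects. *)
Record subcategory (A : abelianCat) (C : A -> Prop) : Prop := Subcategory {
  sub_zero : forall a, is_zero a -> C a;
  sub_biproduct : forall s a b, is_biproduct s a b -> C a -> C b -> C s;
  sub_iso : forall a b (f : hom a b), is_iso f -> C a -> C b
}.

Definition projective (A : abelianCat) (p : A) : Prop :=
  forall (a b : A) (e : hom a b) (f : hom p b), epi e ->
    exists g : hom p a, e \o g = f.

Definition injective_ob (A : abelianCat) (q : A) : Prop :=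
  forall (a b : A) (m : hom a b) (f : hom a q), mono m ->
    exists g : hom b q, g \o m = f.

(** * Complexes *)

(* Homological indexing by all integers.  To avoid transport between the
   indices n + 1 - 1 and n, a complex carries a map between any two degrees,
   which is zero unless it is of the form C_n -> C_(n-1). *)
Record complex (A : abelianCat) := Complex {
  cob :> int -> A;
  dif : forall i j, hom (cob i) (cob j);
  dif_shape : forall i j, i != j + 1 -> dif i j = 0;
  difK : forall i j k, dif j k \o dif i j = 0
}.

Arguments dif {A} c i j.

Record chain_map (A : abelianCat) (C D : complex A) := ChainMap {
  cmap :> forall n, hom (C n) (D n);
  cmapE : forall i j, dif D i j \o cmap i = cmap j \o dif C i j
}.

Section Homology.
Variables (A : abelianCat) (C : complex A).

Definition cycles (n : int) : A := kerob (dif C n (n - 1)).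

Definition boundary (n : int) : hom (C (n + 1)) (cycles n) :=
  kerlift (difK C (n + 1) n (n - 1)).

Definition homology (n : int) : A := cokob (boundary n).

End Homology.

(** * Homology of complexes of abelian groups *)

Record abcomplex := AbComplex {
  abob :> int -> zmodType;
  abd : forall i j, {additive abob i -> abob j};
  abd_shape : forall i j, i != j + 1 -> forall x, abd i j x = 0;
  abdK : forall i j k x, abd j k (abd i j x) = 0
}.

Arguments abd a i j : clear implicits.

Record abmap (K L : abcomplex) := AbMap {
  abf :> forall n, {additive K n -> L n};
  abfE : forall i j x, abd L i j (abf i x) = abf j (abd K i j x)
}.

Section AbHomology.
Variables (K : abcomplex) (n : int).

Definition abcycle : pred (K n) := fun x => abd K n (n - 1) x == 0.

Fact abcycle_closed : zmod_closed abcycle.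
Proof.
split=> [|x y]; first by rewrite unfold_in raddf0.
by rewrite !unfold_in raddfB => /eqP-> /eqP->; rewrite subrr.
Qed.
HB.instance Definition _ :=
  GRing.isZmodClosed.Build (K n) abcycle abcycle_closed.

Definition abZ : Type := {x : K n | x \in abcycle}.
HB.instance Definition _ := SubChoice.on abZ.
HB.instance Definition _ := [SubChoice_isSubZmodule of abZ by <:].

Definition abbound : pred abZ :=
  fun z => `[< exists y : K (n + 1), abd K (n + 1) n y = val z >].

Fact abbound_closed : zmod_closed abbound.
Proof.
split=> [|u v]; rewrite !unfold_in; first by apply/asboolP; exists 0; rewrite !raddf0.
move=> /asboolP[x xu] /asboolP[y yv]; apply/asboolP; exists (x - y).
by rewrite !raddfB xu yv.
Qed.
HB.instance Definition _ :=
  GRing.isZmodClosed.Build abZ abbound abbound_closed.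

Definition abH : zmodType := Quotient.quot (GRing.ZmodClosed.clone _ abbound _).

End AbHomology.

Arguments abcycle K n : clear implicits.
Arguments abbound K n : clear implicits.

Section AbHomologyMap.
Variables (K L : abcomplex) (f : abmap K L) (n : int).

Fact abZmap_subproof (z : abZ K n) : f n (val z) \in abcycle L n.
Proof.
by have := valP z; rewrite !unfold_in abfE => /eqP->; rewrite raddf0.
Qed.

Definition abZmap (z : abZ K n) : abZ L n := Sub (f n (val z)) (abZmap_subproof z).

Definition abHmap (h : abH K n) : abH L n := \pi_(abH L n)%qT (abZmap (repr h)).

Lemma abHmap_pi (z : abZ K n) :
  abHmap (\pi_(abH K n)%qT z) = \pi_(abH L n)%qT (abZmap z).
Proof.
apply/eqP; rewrite -Quotient.idealrBE.
have : repr (\pi_(abH K n)%qT z) - z \in abbound K n.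
  by rewrite Quotient.idealrBE reprK.
rewrite !unfold_in => /asboolP[y yE]; apply/asboolP; exists (f (n + 1) y).
by rewrite abfE yE !raddfB.
Qed.

Fact abHmap_additive : zmod_morphism abHmap.
Proof.
move=> g h; rewrite -[g]reprK -[h]reprK -raddfB !abHmap_pi -raddfB.
by congr (\pi_(abH L n)%qT _); apply: val_inj; rewrite /= !raddfB.
Qed.
HB.instance Definition _ :=
  GRing.isZmodMorphism.Build (abH K n) (abH L n) abHmap abHmap_additive.

End AbHomologyMap.

Arguments abHmap {K L} f n _.

Definition abexact (K : abcomplex) : Prop :=
  forall n (x : K n), abd K n (n - 1) x = 0 -> exists y, abd K (n + 1) n y = x.

(** * Hom complexes *)

Section HomComplexes.
Variable A : abelianCat.

Section PrePost.
Variables (a b c : A).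

Definition postcomp (g : hom b c) (f : hom a b) : hom a c := g \o f.
Fact postcomp_additive g : zmod_morphism (postcomp g).
Proof. by move=> f f'; apply: compBr. Qed.
HB.instance Definition _ g :=
  GRing.isZmodMorphism.Build (hom a b) (hom a c) (postcomp g)
    (postcomp_additive g).

Definition precomp (f : hom a b) (g : hom b c) : hom a c := g \o f.
Fact precomp_additive f : zmod_morphism (precomp f).
Proof. by move=> g g'; apply: compBl. Qed.
HB.instance Definition _ f :=
  GRing.isZmodMorphism.Build (hom b c) (hom a c) (precomp f)
    (precomp_additive f).

End PrePost.

(* Hom(a, C) *)
Section HomR.
Variables (a : A) (C : complex A).

Definition homR_d (i j : int) : {additive hom a (C i) -> hom a (C j)} :=
  postcomp (dif C i j).

Fact homR_shape i j : i != j + 1 -> forall x, homR_d i j x = 0.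
Proof. by move=> ij x; rewrite /= /postcomp dif_shape // comp0m. Qed.

Fact homR_dK i j k x : homR_d j k (homR_d i j x) = 0.
Proof. by rewrite /= /postcomp compA difK comp0m. Qed.

Definition homR : abcomplex := AbComplex homR_shape homR_dK.
End HomR.

(* Hom(C, a), with Hom(C_n, a) in degree -n.  The sign that some authors put on
   the differential is omitted: it affects neither cycles nor boundaries. *)
Section HomL.
Variables (C : complex A) (a : A).

Definition homL_d (i j : int) : {additive hom (C (- i)) a -> hom (C (- j)) a} :=
  precomp (dif C (- j) (- i)).

Fact homL_shape i j : i != j + 1 -> forall x, homL_d i j x = 0.
Proof. by move=> ij x; rewrite /= /precomp dif_shape ?compm0 //; lia. Qed.

Fact homL_dK i j k x : homL_d j k (homL_d i j x) = 0.
Proof. by rewrite /= /precomp -compA difK compm0. Qed.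

Definition homL : abcomplex := AbComplex homL_shape homL_dK.
End HomL.

Section HomMaps.
Variables (C D : complex A) (f : chain_map C D) (a : A).

Definition homR_f (n : int) : {additive homR a C n -> homR a D n} :=
  postcomp (f n).
Fact homR_fE i j x :
  abd (homR a D) i j (homR_f i x) = homR_f j (abd (homR a C) i j x).
Proof. by rewrite /= /postcomp !compA cmapE. Qed.
Definition homR_map : abmap (homR a C) (homR a D) := AbMap homR_fE.

Definition homL_f (n : int) : {additive homL D a n -> homL C a n} :=
  precomp (f (- n)).
Fact homL_fE i j x :
  abd (homL C a) i j (homL_f i x) = homL_f j (abd (homL D a) i j x).
Proof. by rewrite /= /precomp -!compA cmapE. Qed.
Definition homL_map : abmap (homL D a) (homL C a) := AbMap homL_fE.

End HomMaps.
End HomComplexes.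

(** * Resolutions and coresolutions *)

Section Resolutions.
Variable A : abelianCat.
Implicit Types (C : A -> Prop) (M N : A).

Record resolution C M := Resolution {
  res :> complex A;
  res_in : forall n, C (res n);
  res_neg : forall n : int, n < 0 -> is_zero (res n);
  res_acyclic : forall n : int, 0 < n -> is_zero (homology res n);
  res_H0 : hom (homology res 0) M;
  res_H0_iso : is_iso res_H0
}.

Record coresolution C N := Coresolution {
  cores :> complex A;
  cores_in : forall n, C (cores n);
  cores_pos : forall n : int, 0 < n -> is_zero (cores n);
  cores_acyclic : forall n : int, n < 0 -> is_zero (homology cores n);
  cores_H0 : hom N (homology cores 0);
  cores_H0_iso : is_iso cores_H0
}.

Section Augmented.
Variables (C : A -> Prop) (M : A) (R : resolution C M).

Fact res_d0 : dif R 0 (0 - 1) \o idm (R 0) = 0.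
Proof. by rewrite compm1; apply: (res_neg _ _ _).2. Qed.

(* R_0 = Z_0(R) ->> H_0(R) ~ M *)
Definition res_aug : hom (R 0) M :=
  res_H0 R \o cokmap (boundary R 0) \o kerlift res_d0.

Fact res_aug_d i : res_aug \o dif R i 0 = 0.
Proof.
have [->|i1] := eqVneq i (0 + 1); last by rewrite dif_shape // compm0.
have -> : dif R (0 + 1) 0 = kermap (dif R 0 (0 - 1)) \o boundary R 0.
  by rewrite kerliftK.
rewrite /res_aug -!compA.
have -> : kerlift res_d0 \o (kermap (dif R 0 (0 - 1)) \o boundary R 0)
          = boundary R 0.
  have [_ km _] := kermapP (dif R 0 (0 - 1)).
  by apply: km; rewrite !compA kerliftK comp1m.
by have [-> _ _] := cokmapP (boundary R 0); rewrite compm0.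
Qed.

(* ... -> R_1 -> R_0 -> M -> 0 with M in degree -1 = Negz 0 *)
Definition aug_ob (n : int) : A :=
  match n with
  | Posz _ => R n
  | Negz 0 => M
  | Negz _.+1 => zob A
  end.

Definition aug_dif (i j : int) : hom (aug_ob i) (aug_ob j) :=
  match j, i return hom (aug_ob i) (aug_ob j) with
  | Posz n, Posz m => dif R (Posz m) (Posz n)
  | Negz 0, Posz 0 => res_aug
  | _, _ => 0
  end.

Fact aug_shape i j : i != j + 1 -> aug_dif i j = 0.
Proof.
by case: i j => [[|m]|m] [n|[|n]] //= mn; apply: dif_shape.
Qed.

Fact aug_difK i j k : aug_dif j k \o aug_dif i j = 0.
Proof.
case: j => [n|[|n]]; last 2 first.
- by rewrite (_ : aug_dif (Negz 0) k = 0) ?comp0m //; case: k => [?|[|?]].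
- by rewrite (_ : aug_dif (Negz n.+1) k = 0) ?comp0m //; case: k => [?|[|?]].
case: i => [m|m]; last by rewrite [aug_dif (Negz _) _]/= compm0.
case: k => [k|[|k]]; [exact: difK | | exact: comp0m].
by case: n => [|n]; [exact: res_aug_d | exact: comp0m].
Qed.

Definition augmented : complex A := Complex aug_shape aug_difK.

Definition proper_resolution : Prop :=
  forall c, C c -> abexact (homR c augmented).

Definition bounded_resolution : Prop :=
  exists b : int, forall n, b < n -> is_zero (R n).

End Augmented.

Section CoAugmented.
Variables (C : A -> Prop) (N : A) (R : coresolution C N).

Fact cores_d0 : kermap (dif R 0 (0 - 1)) \o boundary R 0 = 0.
Proof. by rewrite kerliftK; apply: (cores_pos _ _ _).1. Qed.

(* N ~ H_0(R) = Z_0(R) >-> R_0 *)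
Definition cores_aug : hom N (R 0) :=
  cokdesc cores_d0 \o cores_H0 R.

Fact cores_aug_d i : dif R 0 i \o cores_aug = 0.
Proof.
have [->|i1] := eqVneq i (0 - 1); last first.
  by rewrite dif_shape ?comp0m //; lia.
rewrite /cores_aug compA (_ : dif R 0 (0 - 1) \o cokdesc cores_d0 = 0) ?comp0m //.
have [_ ep _] := cokmapP (boundary R 0).
apply: ep; rewrite -compA cokdescK comp0m.
by have [-> _ _] := kermapP (dif R 0 (0 - 1)).
Qed.

(* 0 -> N -> R_0 -> R_(-1) -> ... with N in degree 1 *)
Definition coaug_ob (n : int) : A :=
  match n with
  | Posz 0 => R 0
  | Posz 1 => N
  | Posz _.+2 => zob A
  | Negz n => R (Negz n)
  end.

Definition coaug_dif (i j : int) : hom (coaug_ob i) (coaug_ob j) :=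
  match i, j return hom (coaug_ob i) (coaug_ob j) with
  | Posz 0, Posz 0 => dif R 0 0
  | Posz 0, Negz n => dif R 0 (Negz n)
  | Negz m, Posz 0 => dif R (Negz m) 0
  | Negz m, Negz n => dif R (Negz m) (Negz n)
  | Posz 1, Posz 0 => cores_aug
  | _, _ => 0
  end.

Fact coaug_shape i j : i != j + 1 -> coaug_dif i j = 0.
Proof.
by case: i j => [[|[|m]]|m] [[|[|n]]|n] //= mn; apply: dif_shape.
Qed.

Fact coaug_difK i j k : coaug_dif j k \o coaug_dif i j = 0.
Proof.
case: j => [[|[|n]]|n].
- case: k => [[|[|k]]|k]; rewrite ?comp0m //.
    by case: i => [[|[|m]]|m]; rewrite ?compm0 //= ?difK ?cores_aug_d.
  by case: i => [[|[|m]]|m]; rewrite ?compm0 //= ?difK ?cores_aug_d.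
- by rewrite (_ : coaug_dif i 1 = 0) ?compm0 //; case: i => [[|[|m]]|m].
- by rewrite (_ : coaug_dif i n.+2 = 0) ?compm0 //; case: i => [[|[|m]]|m].
- case: k => [[|[|k]]|k]; rewrite ?comp0m //;
  by case: i => [[|[|m]]|m]; rewrite ?compm0 //= ?difK.
Qed.

Definition coaugmented : complex A := Complex coaug_shape coaug_difK.

Definition proper_coresolution : Prop :=
  forall c, C c -> abexact (homL coaugmented c).

Definition bounded_coresolution : Prop :=
  exists b : int, forall n, n < b -> is_zero (R n).

End CoAugmented.

Definition res_hat C M : Prop := exists R : resolution C M, bounded_resolution R.
Definition res_tilde C M : Prop := exists R : resolution C M, proper_resolution R.
Definition cores_hat C N : Prop :=
  exists R : coresolution C N, bounded_coresolution R.
Definition cores_tilde C N : Prop :=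
  exists R : coresolution C N, proper_coresolution R.

End Resolutions.

(** * Yoneda Ext and orthogonality *)

Section YonedaExt.
Variable A : abelianCat.
Implicit Types c d : A.

(* An n-fold extension 0 -> d -> E_n -> ... -> E_1 -> c -> 0, as an acyclic
   complex in degrees 0, ..., n + 1 whose end terms are identified with c and
   d. *)
Record extension (n : nat) c d := Extension {
  ext :> complex A;
  ext_exact : forall k, is_zero (homology ext k);
  ext_out : forall k : int, (k < 0) || (n.+1%:Z < k) -> is_zero (ext k);
  ext_right : hom (ext 0) c;
  ext_right_iso : is_iso ext_right;
  ext_left : hom d (ext n.+1);
  ext_left_iso : is_iso ext_left
}.

Definition ext_morphism n c d (E F : extension n c d) : Prop :=
  exists f : chain_map E F,
    ext_right F \o f 0 = ext_right E /\ f n.+1 \o ext_left E = ext_left F.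

(* Ext^n(c, d), for n >= 1, is the set of classes of this relation. *)
Definition ext_equiv n c d : extension n c d -> extension n c d -> Prop :=
  clos_refl_sym_trans _ (@ext_morphism n c d).

(* The group Ext^n(c, d) is trivial iff it has a single element. *)
Definition Ext_vanishes n c d : Prop :=
  forall E F : extension n c d, ext_equiv E F.

Definition Ext_orthogonal (C D : A -> Prop) : Prop :=
  forall (n : nat) c d, (1 <= n)%N -> C c -> D d -> Ext_vanishes n c d.

End YonedaExt.

(** * Relative Ext and comparison maps *)

Section RelativeExt.
Variable A : abelianCat.

(* Ext_{XA}^n(M, N), computed from a proper X-resolution R of M.  For X the
   class of projective objects this is Ext_A^n(M, N). *)
Definition ExtXA (X : A -> Prop) (M : A) (R : resolution X M) (N : A) (n : int) :
    zmodType :=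
  abH (homL R N) (- n).

(* Ext_{AY}^n(M, N), computed from a proper Y-coresolution R of N.  For Y the
   class of injective objects this is Ext_A^n(M, N). *)
Definition ExtAY (Y : A -> Prop) (N : A) (R : coresolution Y N) (M : A) (n : int) :
    zmodType :=
  abH (homR M R) (- n).

Section XA.
Variables (X : A -> Prop) (M : A).
Variables (P : resolution (@projective A) M) (R : resolution X M).

Definition lifts_id (phi : chain_map P R) : Prop :=
  res_aug R \o phi 0 = res_aug P.

Definition kappaXA (phi : chain_map P R) (N : A) (n : int) :
    {additive ExtXA R N n -> ExtXA P N n} :=
  abHmap (homL_map phi N) (- n).
End XA.

Section AY.
Variables (Y : A -> Prop) (N : A).
Variables (R : coresolution Y N) (I : coresolution (@injective_ob A) N).

Definition extends_id (phi : chain_map R I) : Prop :=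
  phi 0 \o cores_aug R = cores_aug I.

Definition kappaAY (phi : chain_map R I) (M : A) (n : int) :
    {additive ExtAY R M n -> ExtAY I M n} :=
  abHmap (homR_map phi M) (- n).
End AY.

End RelativeExt.

(* Main.v *)
(** For (a), call c acyclic for d when Ext^n(c, d) = 0 for all n >= 1.  Along
    the short exact sequences of a bounded W-resolution of N, dimension shifting
    turns the orthogonality of X and W into: every object of X is acyclic for N;
    projective objects are so trivially.  The mapping cone of P -> X is an exact
    complex, bounded below, whose terms P_(k-1) (+) X_k are therefore acyclic
    for N; dimension shifting again shows that its syzygies are acyclic for N, so
    that Hom(-, N) keeps it exact, which says that Hom(X, N) -> Hom(P, N) is a
    quasi-isomorphism.  Part (b) is dual.

    There may be too few projectives or injectives to compute Ext, so the long
    exact sequences behind dimension shifting are needed for Yoneda Ext.  Only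
    the vanishing of classes matters: a class is zero iff it is killed by
    successively refining the first short exact sequence, and this criterion is
    invariant under morphisms of extensions. *)

Require Import Defs.
From mathcomp Require Import all_boot all_order all_algebra.
From mathcomp Require Import zify boolp.
From Stdlib Require Import Relation_Operators.
(* [all_algebra] has shadowed [hom]. *)
Import Defs.

Set Implicit Arguments.
Unset Strict Implicit.
Unset Printing Implicit Defensive.

Import GRing.Theory.
Local Open Scope ring_scope.
Local Open Scope cat_scope.

(** * Biproducts, pullbacks and diagram chases in an abelian category *)

Section AbelianTools.
Variable A : abelianCat.
Implicit Types a b c d e k q x z : A.

Lemma epi0 a b (f : hom a b) :
  (forall c (g : hom b c), g \o f = 0 -> g = 0) -> epi f.
Proof.
by move=> f0 c g h gh; apply/eqP; rewrite -subr_eq0 (f0 _ (g - h)) // compBl gh subrr.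
Qed.

Lemma epi_eq0 a b c (f : hom a b) (g : hom b c) : epi f -> g \o f = 0 -> g = 0.
Proof. by move=> ef gf; apply: ef; rewrite gf comp0m. Qed.

Lemma mono0 a b (f : hom a b) :
  (forall c (g : hom c a), f \o g = 0 -> g = 0) -> mono f.
Proof.
by move=> f0 c g h gh; apply/eqP; rewrite -subr_eq0 (f0 _ (g - h)) // compBr gh subrr.
Qed.

Lemma mono_eq0 a b c (f : hom a b) (g : hom c a) : mono f -> f \o g = 0 -> g = 0.
Proof. by move=> mf fg; apply: mf; rewrite fg compm0. Qed.

Lemma epi_comp a b c (f : hom a b) (g : hom b c) : epi f -> epi g -> epi (g \o f).
Proof. by move=> ef eg x u v; rewrite !compA => /ef /eg. Qed.

Lemma epi_compl a b c (f : hom a b) (g : hom b c) : epi (g \o f) -> epi g.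
Proof. by move=> e x u v uv; apply: e; rewrite !compA uv. Qed.

Lemma epi_id a : epi (idm a).
Proof. by move=> x u v; rewrite !compm1. Qed.

Lemma mono_id a : mono (idm a).
Proof. by move=> x u v; rewrite !comp1m. Qed.

Lemma mono_comp a b c (f : hom a b) (g : hom b c) : mono f -> mono g -> mono (g \o f).
Proof. by move=> mf mg x u v; rewrite -!compA => /mg /mf. Qed.

Lemma iso_epi a b (f : hom a b) : is_iso f -> epi f.
Proof. by case=> g [_ fg]; apply: (@epi_compl _ _ _ g); rewrite fg; apply: epi_id. Qed.

Lemma iso_mono a b (f : hom a b) : is_iso f -> mono f.
Proof.
case=> g [gf _]; apply: mono0 => x h fh.
by rewrite -[h]comp1m -gf -compA fh compm0.
Qed.

(** By normality [p] is the cokernel of some [h], which factors through [i]; so whatever kills [i]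
    kills [h]. *)
Lemma epi_coker a b (p : hom a b) : epi p ->
  forall k (i : hom k a), is_kernel i p -> is_cokernel p i.
Proof.
move=> ep k i [pi _ kp]; split=> // d g gi.
have [c [h [ph _ cp]]] := epi_normal (abelianP A) ep.
by apply: cp; have [w <-] := kp _ _ ph; rewrite compA gi comp0m.
Qed.

Lemma mono_ker a b (i : hom a b) : mono i ->
  forall c (p : hom b c), is_cokernel p i -> is_kernel i p.
Proof.
move=> mi c p [pi _ cp]; split=> // d g pg.
have [k [h [hi _ kh]]] := mono_normal (abelianP A) mi.
by apply: kh; have [w <-] := cp _ _ hi; rewrite -compA pg compm0.
Qed.

Fact bp_data a b : {s : A & {m : hom a s * hom b s * hom s a * hom s b |
  let: (i, j, p, q) := m in
  [/\ p \o i = idm a, q \o j = idm b, q \o i = 0, p \o j = 0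
      & (i \o p) + (j \o q) = idm s]}}.
Proof.
have /cid[s bs] := has_biproduct (abelianP A) a b.
exists s; apply: cid; have [i [j [p [q H]]]] := bs.
by exists (i, j, p, q).
Qed.

Definition bp a b : A := projT1 (bp_data a b).
Definition in1 a b : hom a (bp a b) := (sval (projT2 (bp_data a b))).1.1.1.
Definition in2 a b : hom b (bp a b) := (sval (projT2 (bp_data a b))).1.1.2.
Definition pr1 a b : hom (bp a b) a := (sval (projT2 (bp_data a b))).1.2.
Definition pr2 a b : hom (bp a b) b := (sval (projT2 (bp_data a b))).2.

Lemma bpP a b : [/\ pr1 a b \o in1 a b = idm a, pr2 a b \o in2 a b = idm b,
  pr2 a b \o in1 a b = 0, pr1 a b \o in2 a b = 0
  & (in1 a b \o pr1 a b) + (in2 a b \o pr2 a b) = idm (bp a b)].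
Proof.
by rewrite /in1 /in2 /pr1 /pr2 /bp; case: (bp_data a b) => s [[[[i j] p] q] H] /=.
Qed.

Definition pairm a b x (f : hom x a) (g : hom x b) : hom x (bp a b) :=
  (in1 a b \o f) + (in2 a b \o g).
Definition copairm a b x (f : hom a x) (g : hom b x) : hom (bp a b) x :=
  (f \o pr1 a b) + (g \o pr2 a b).

Lemma pr1_pair a b x (f : hom x a) (g : hom x b) : pr1 a b \o pairm f g = f.
Proof.
by have [h1 _ _ h2 _] := bpP a b; rewrite compDr !compA h1 h2 comp1m comp0m addr0.
Qed.

Lemma pr2_pair a b x (f : hom x a) (g : hom x b) : pr2 a b \o pairm f g = g.
Proof.
by have [_ h1 h2 _ _] := bpP a b; rewrite compDr !compA h1 h2 comp1m comp0m add0r.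
Qed.

Lemma pair_eta a b x (h : hom x (bp a b)) : pairm (pr1 a b \o h) (pr2 a b \o h) = h.
Proof. by have [_ _ _ _ h5] := bpP a b; rewrite /pairm !compA -compDl h5 comp1m. Qed.

Lemma pair_comp a b x y (f : hom x a) (g : hom x b) (h : hom y x) :
  pairm f g \o h = pairm (f \o h) (g \o h).
Proof. by rewrite compDl -!compA. Qed.

Lemma bp_ext a b x (h h' : hom x (bp a b)) :
  pr1 a b \o h = pr1 a b \o h' -> pr2 a b \o h = pr2 a b \o h' -> h = h'.
Proof. by move=> e1 e2; rewrite -[h]pair_eta e1 e2 pair_eta. Qed.

Lemma copair_pair a b x y (f : hom a y) (g : hom b y) (u : hom x a) (v : hom x b) :
  copairm f g \o pairm u v = (f \o u) + (g \o v).
Proof. by rewrite compDl -!compA pr1_pair pr2_pair. Qed.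

Lemma in1_pair a b : in1 a b = pairm (idm a) 0.
Proof. by rewrite /pairm compm1 compm0 addr0. Qed.

Lemma in2_pair a b : in2 a b = pairm 0 (idm b).
Proof. by rewrite /pairm compm1 compm0 add0r. Qed.

Lemma copair_in1 a b y (f : hom a y) (g : hom b y) : copairm f g \o in1 a b = f.
Proof. by rewrite in1_pair copair_pair compm1 compm0 addr0. Qed.

Lemma copair_in2 a b y (f : hom a y) (g : hom b y) : copairm f g \o in2 a b = g.
Proof. by rewrite in2_pair copair_pair compm1 compm0 add0r. Qed.

Lemma bp_coext a b x (h h' : hom (bp a b) x) :
  h \o in1 a b = h' \o in1 a b -> h \o in2 a b = h' \o in2 a b -> h = h'.
Proof.
move=> e1 e2; have [_ _ _ _ e] := bpP a b.
by rewrite -[h]compm1 -[h']compm1 -e !compDr !compA e1 e2.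
Qed.

Lemma copair_comp a b x y (f : hom a x) (g : hom b x) (h : hom x y) :
  h \o copairm f g = copairm (h \o f) (h \o g).
Proof. by rewrite compDr !compA. Qed.

Section Pullback.
Variables (a b c : A) (f : hom a c) (g : hom b c).

Definition pb : A := kerob (copairm f (- g)).
Definition pb1 : hom pb a := pr1 a b \o kermap (copairm f (- g)).
Definition pb2 : hom pb b := pr2 a b \o kermap (copairm f (- g)).

Lemma compNl x y w (u : hom y w) (v : hom x y) : (- u) \o v = - (u \o v).
Proof. by rewrite -[- u]add0r compBl comp0m add0r. Qed.

Lemma compNr x y w (u : hom y w) (v : hom x y) : u \o (- v) = - (u \o v).
Proof. by rewrite -[- v]add0r compBr compm0 add0r. Qed.

Lemma pbE : f \o pb1 = g \o pb2.
Proof.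
have [h _ _] := kermapP (copairm f (- g)); apply/eqP; rewrite -subr_eq0 -compNl.
by rewrite -copair_pair pair_eta h.
Qed.

Lemma pb_lift x (u : hom x a) (v : hom x b) : f \o u = g \o v ->
  exists h : hom x pb, pb1 \o h = u /\ pb2 \o h = v.
Proof.
move=> uv; have [_ _ kp] := kermapP (copairm f (- g)).
have [|h hE] := kp _ (pairm u v); first by rewrite copair_pair uv compNl subrr.
by exists h; rewrite -!compA hE pr1_pair pr2_pair.
Qed.

Lemma pb_ext x (u v : hom x pb) : pb1 \o u = pb1 \o v -> pb2 \o u = pb2 \o v -> u = v.
Proof.
move=> e1 e2; have [_ m _] := kermapP (copairm f (- g)).
by apply: m; apply: bp_ext; rewrite !compA.
Qed.

(** Since [g] is epi, so is [copairm f (- g)], which is then the cokernel of its kernel. If [u]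
    kills [pb1], then [u] after the first projection factors through it, and restriction to [b]
    shows that the factor is zero. *)
Lemma pb1_epi : epi g -> epi pb1.
Proof.
move=> eg; apply: epi0 => x u u0.
have ek : epi (copairm f (- g)).
  apply: epi0 => y h h0; apply: (epi_eq0 eg); apply/eqP; rewrite -oppr_eq0.
  by rewrite -compNr -(copair_in2 f (- g)) compA h0 comp0m.
have [_ _ ck] := epi_coker ek (kermapP _).
have [|w wE] := ck _ (u \o pr1 a b); first by rewrite -compA.
have w0 : w = 0.
  apply: (epi_eq0 eg); apply/eqP; rewrite -oppr_eq0.
  rewrite -compNr -(copair_in2 f (- g)) compA wE -compA.
  by have [_ _ _ -> _] := bpP a b; rewrite compm0.
have [h1 _ _ _ _] := bpP a b.
by rewrite -[u]compm1 -h1 compA -wE w0 !comp0m.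
Qed.

End Pullback.

(** Stands in for choosing preimages: generalized elements lift along an epimorphism after an
    epimorphic change of domain. *)
Lemma epi_cover e c q (p : hom e c) (f : hom q c) : epi p ->
  exists q' (t : hom q' q) (w : hom q' e), epi t /\ p \o w = f \o t.
Proof.
by move=> ep; exists (pb f p), (pb1 f p), (pb2 f p); split; rewrite ?pbE //; apply: pb1_epi.
Qed.

(** Undoes a change of domain: as [m] is mono, [v] kills the kernel of [e], and [e] is the cokernel
    of that kernel. *)
Lemma epi_descend a b x y (e : hom a b) (m : hom x y) (u : hom b y) (v : hom a x) :
  epi e -> mono m -> u \o e = m \o v -> exists w : hom b x, u = m \o w /\ v = w \o e.
Proof.
move=> ee mm ue.
have [ke _ _] := kermapP e; have [_ _ ce] := epi_coker ee (kermapP e).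
have [|w wE] := ce _ v; first by apply: (mono_eq0 mm); rewrite compA -ue -compA ke compm0.
by exists w; split=> //; apply: ee; rewrite -compA wE.
Qed.

(** * Short exact sequences *)
Record ses z c := Ses {
  mid : A;
  inc : hom z mid;
  prj : hom mid c;
  ses_ker : is_kernel inc prj;
  prj_epi : epi prj
}.

Lemma prj_inc z c (s : ses z c) : prj s \o inc s = 0.
Proof. by have [] := ses_ker s. Qed.

Lemma inc_mono z c (s : ses z c) : mono (inc s).
Proof. by have [] := ses_ker s. Qed.

Lemma inc_lift z c (s : ses z c) x (u : hom x (mid s)) : prj s \o u = 0 ->
  exists v, inc s \o v = u.
Proof. by have [_ _ kp] := ses_ker s; apply: kp. Qed.

Lemma prj_desc z c (s : ses z c) x (u : hom (mid s) x) : u \o inc s = 0 ->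
  exists v, v \o prj s = u.
Proof. by have [_ _ kp] := epi_coker (@prj_epi _ _ s) (ses_ker s); apply: kp. Qed.

Definition ses_of_epi a c (p : hom a c) (ep : epi p) : ses (kerob p) c :=
  Ses (kermapP p) ep.

(** The last two clauses are the universal property of the pullback, exported so that its
    construction can stay hidden. *)
Lemma ses_pull z c q (s : ses z c) (f : hom q c) :
  exists (s' : ses z q) (g : hom (mid s') (mid s)),
  [/\ prj s \o g = f \o prj s', g \o inc s' = inc s,
      forall x (u : hom x (mid s)) (v : hom x q), prj s \o u = f \o v ->
        exists w, g \o w = u /\ prj s' \o w = v
    & forall x (u v : hom x (mid s')),
        g \o u = g \o v -> prj s' \o u = prj s' \o v -> u = v].
Proof.
have [|i [i1 i2]] := @pb_lift _ _ _ f (prj s) _ 0 (inc s).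
  by rewrite compm0 prj_inc.
have ki : is_kernel i (pb1 f (prj s)).
  split=> // [x u v uv|x u u0].
    by apply: (@inc_mono _ _ s); rewrite -i2 -!compA uv.
  have [|w wE] := @inc_lift _ _ s _ (pb2 f (prj s) \o u).
    by rewrite compA -pbE -compA u0 compm0.
  by exists w; apply: pb_ext; rewrite compA ?i1 ?i2 // u0 comp0m.
exists (Ses ki (pb1_epi (@prj_epi _ _ s))), (pb2 f (prj s)); split=> //=.
- by rewrite pbE.
- by move=> x u v uv; have [|w [w1 w2]] := @pb_lift _ _ _ f (prj s) _ v u; [|exists w].
- by move=> x u v e2 e1; apply: pb_ext.
Qed.

(** The pushout is the cokernel of [pairm h (- inc s)]; the last two clauses are its universal
    property. *)
Lemma ses_push z c d (s : ses z c) (h : hom z d) :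
  exists (s' : ses d c) (g : hom (mid s) (mid s')),
  [/\ prj s' \o g = prj s, inc s' \o h = g \o inc s,
      forall x (u : hom d x) (v : hom (mid s) x), u \o h = v \o inc s ->
        exists w, w \o inc s' = u /\ w \o g = v
    & forall x (u v : hom (mid s') x),
        u \o inc s' = v \o inc s' -> u \o g = v \o g -> u = v].
Proof.
pose m := pairm h (- inc s); pose ck := cokmap m.
have [ck0 eck uck] := cokmapP m.
have mm : mono m.
  apply: mono0 => x u /(congr1 (comp (pr2 _ _))).
  rewrite compA pr2_pair compm0 compNl => /eqP; rewrite oppr_eq0 => /eqP.
  exact/mono_eq0/inc_mono.
have [_ _ km] := mono_ker mm (cokmapP m).
pose i := ck \o in1 d (mid s); pose g := ck \o in2 d (mid s).
have ih : i \o h = g \o inc s.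
  apply/eqP; rewrite -subr_eq0 -compNr -!compA -compDr.
  by rewrite -/(pairm _ _) [ck \o _]ck0.
have desc x (u : hom d x) (v : hom (mid s) x) : u \o h = v \o inc s ->
        exists w, w \o i = u /\ w \o g = v.
  move=> uv; have [|w wE] := uck _ (copairm u v).
    by rewrite copair_pair compNr uv subrr.
  by exists w; rewrite !compA wE copair_in1 copair_in2.
have ext x (u v : hom (cokob m) x) : u \o i = v \o i -> u \o g = v \o g -> u = v.
  by rewrite /i /g !compA => e1 e2; apply: eck; apply: bp_coext.
have [|p [pi pg]] := desc _ 0 (prj s); first by rewrite comp0m prj_inc.
have ep : epi p by apply: (@epi_compl _ _ _ g); rewrite pg; apply: prj_epi.
(* Being mono, [m] is the kernel of its cokernel; so an element of [d] killed by [i] comes from [z],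
   where the component [- inc s] forces it to be zero. *)
have mi : mono i.
  apply: mono0 => x u; rewrite /i -compA => /km[w /[dup] w1].
  move=> /(congr1 (comp (pr2 _ _))); rewrite compA pr2_pair compA.
  have [h1 _ -> _ _] := bpP d (mid s); rewrite comp0m compNl => /eqP.
  rewrite oppr_eq0 => /eqP /(mono_eq0 (@inc_mono _ _ s)) w0.
  by rewrite -[u]comp1m -h1 -compA -w1 w0 !compm0.
have ki : is_kernel i p.
  split=> // x u pu.
  (* Locally [u] is the class of a pair [w]. Its second component comes from [z], so [h] moves it
     into [d]; the factorization through [i] then descends. *)
  have [x' [t [w [et wE]]]] := epi_cover u eck.
  have [|v vE] := @inc_lift _ _ s _ (pr2 _ _ \o w).
    rewrite -pg /g; have e : w = pairm (pr1 _ _ \o w) (pr2 _ _ \o w) by rewrite pair_eta.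
    have : p \o ck \o w = 0 by rewrite -compA [ck \o w]wE compA pu comp0m.
    by rewrite {1}e compDr !compA -[_ \o in1 _ _]compA -/i pi !comp0m add0r -!compA.
  have [|r [rE _]] := @epi_descend _ _ _ _ t i u ((pr1 _ _ \o w) + (h \o v)) et mi.
    rewrite -wE compDr [i \o (h \o v)]compA ih -compA vE.
    by rewrite -{1}[w]pair_eta compDr !compA.
  by exists r.
by exists (Ses ki ep), g; split.
Qed.

(** The snake lemma for a morphism of short exact sequences over the identity of [q]: [p] and [b]
    have the same kernel and cokernel. *)
Lemma ses_quot z z' q d (s : ses z q) (s' : ses z' q) (l : hom d z') (p : hom z' z)
    (b : hom (mid s') (mid s)) :
  is_kernel l p -> epi p -> inc s \o p = b \o inc s' -> prj s \o b = prj s' ->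
  is_kernel (inc s' \o l) b /\ epi b.
Proof.
move=> [pl ml kp] ep e1 e2; split.
  split; first by rewrite compA -e1 -compA pl compm0.
    by apply: mono_comp => //; apply: inc_mono.
  move=> x u bu; have [|v vE] := @inc_lift _ _ s' _ u; first by rewrite -e2 -compA bu compm0.
  have [|w wE] := kp _ v.
    by apply: (mono_eq0 (@inc_mono _ _ s)); rewrite compA e1 -compA vE.
  by exists w; rewrite -compA wE.
apply: epi0 => x u ub.
have [|v vE] := @prj_desc _ _ s _ u.
  by apply: (epi_eq0 ep); rewrite -compA e1 compA ub comp0m.
rewrite -vE (_ : v = 0) ?comp0m //; apply: (epi_eq0 (@prj_epi _ _ s')).
by rewrite -e2 compA vE.
Qed.

End AbelianTools.

(** * Yoneda extensions and their vanishing *)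

Section Yoneda.
Variable A : abelianCat.
Implicit Types a b c d e k q w x z : A.

(* A Yoneda n-extension of [c] by [d], as [n] spliced short exact sequences. *)
Inductive yon d : A -> Type :=
| Yone c (s : ses d c) : yon d c
| Ycons c z (s : ses z c) (y : yon d z) : yon d c.

Fixpoint ylen d c (y : yon d c) : nat :=
  match y with Yone _ _ => 1 | Ycons _ _ _ y' => (ylen y').+1 end.

(* The class of the pullback of [y] along [f] is zero in Ext: it splits if
   [n = 1]; if [y] is [y'] spliced with [s] and [n > 1], then
   [y' s f = y' f' t] for a morphism [(f', g, f)] from [t] to [s], with
   [y' f' = 0].  No quotient by the zigzag relation is needed. *)
Fixpoint van d c (y : yon d c) : forall q, hom q c -> Prop :=
  match y in yon _ c return forall q, hom q c -> Prop with
  | Yone _ s => fun q f => exists g : hom q (mid s), prj s \o g = f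
  | Ycons _ z s y' => fun q f =>
      exists k (t : ses k q) (g : hom (mid t) (mid s)) (f' : hom k z),
      [/\ prj s \o g = f \o prj t, inc s \o f' = g \o inc t & van y' f']
  end.

(** A relation rather than a structure, so that proofs go by induction along the ladder of short
    exact sequences. *)
Inductive ymor d d' (h : hom d d') :
    forall c c', hom c c' -> yon d c -> yon d' c' -> Prop :=
| Mone c c' (f : hom c c') (s : ses d c) (s' : ses d' c') (g : hom (mid s) (mid s')) :
    prj s' \o g = f \o prj s -> inc s' \o h = g \o inc s ->
    ymor h f (Yone s) (Yone s')
| Mcons c c' (f : hom c c') z z' (f' : hom z z') (s : ses z c) (s' : ses z' c')
    (y : yon d z) (y' : yon d' z') (g : hom (mid s) (mid s')) :
    prj s' \o g = f \o prj s -> inc s' \o f' = g \o inc s ->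
    ymor h f' y y' -> ymor h f (Ycons s y) (Ycons s' y').

(** The fibre product of the middle terms is a common refinement; it puts two witnesses of [van]
    over one sequence. *)
Lemma ses_fiber z1 z2 q (t1 : ses z1 q) (t2 : ses z2 q) :
  exists k (t : ses k q) (m1 : hom (mid t) (mid t1)) (m2 : hom (mid t) (mid t2)),
    prj t1 \o m1 = prj t /\ prj t2 \o m2 = prj t.
Proof.
have ep : epi (prj t1 \o pb1 (prj t1) (prj t2)).
  by apply: epi_comp (@prj_epi _ _ _ t1); apply/pb1_epi/prj_epi.
by exists _, (ses_of_epi ep), (pb1 _ _), (pb2 _ _); split=> //; exact/esym/pbE.
Qed.

Lemma van_comp d c (y : yon d c) q q' (f : hom q c) (u : hom q' q) :
  van y f -> van y (f \o u).
Proof.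
case: y f => [c' s|c' z s y] f /=.
  by case=> g gE; exists (g \o u); rewrite compA gE.
case=> k [t [g [f' [g1 g2 v]]]].
have [t' [h [h1 h2 _ _]]] := ses_pull t u.
exists k, t', (g \o h), f'; split=> //.
  by rewrite compA g1 -!compA h1.
by rewrite -compA h2.
Qed.

Lemma van0 d c (y : yon d c) q : van y (0 : hom q c).
Proof.
elim: y q => [c' s|c' z s y IH] q /=; first by exists 0; rewrite compm0.
exists _, (ses_of_epi (@epi_id _ q)), 0, 0.
by rewrite !compm0 !comp0m; split.
Qed.

Definition ytop d c (y : yon d c) : {e : A & hom e c} :=
  match y with
  | Yone _ s => existT (fun e : A => hom e _) (mid s) (prj s)
  | Ycons _ _ s _ => existT (fun e : A => hom e _) (mid s) (prj s)
  end.

Lemma ytop_epi d c (y : yon d c) : epi (projT2 (ytop y)).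
Proof. by case: y => [c' s|c' z s y] /=; apply: prj_epi. Qed.

(** For a longer extension the witness is the identity cover of [q]: its kernel inclusion is zero,
    so the next map can be 0. *)
Lemma van_lift d c (y : yon d c) q (g : hom q (projT1 (ytop y))) :
  van y (projT2 (ytop y) \o g).
Proof.
case: y g => [c' s|c' z s y] g /=; first by exists g.
exists _, (ses_of_epi (@epi_id _ q)), g, 0 => /=.
have [h _ _] := kermapP (idm q); rewrite comp1m in h.
by rewrite h !compm1 !compm0; split=> //; apply: van0.
Qed.

Lemma vanD d c (y : yon d c) q (f f' : hom q c) : van y f -> van y f' -> van y (f + f').
Proof.
elim: y q f f' => [c' s|c' z s y IH] q f1 f2 /=.
  by move=> [g <-] [g' <-]; exists (g + g'); rewrite compDr.
move=> [k1 [t1 [g1 [h1 [e1 i1 v1]]]]] [k2 [t2 [g2 [h2 [e2 i2 v2]]]]].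
have [k [t [m1 [m2 [p1 p2]]]]] := ses_fiber t1 t2.
have [|u1 u1E] := @inc_lift _ _ _ t1 _ (m1 \o inc t).
  by rewrite compA p1 prj_inc.
have [|u2 u2E] := @inc_lift _ _ _ t2 _ (m2 \o inc t).
  by rewrite compA p2 prj_inc.
exists _, t, ((g1 \o m1) + (g2 \o m2)), ((h1 \o u1) + (h2 \o u2)); split.
- by rewrite compDr compDl !compA e1 e2 -!compA p1 p2.
- by rewrite compDr compDl !compA i1 i2 -!compA u1E u2E.
- by apply: IH; apply: van_comp.
Qed.

Lemma vanN d c (y : yon d c) q (f : hom q c) : van y f -> van y (- f).
Proof. by move=> /(van_comp (- idm q)); rewrite compNr compm1. Qed.

Lemma van_ymor d d' (h : hom d d') c c' (f : hom c c') y y' : ymor h f y y' ->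
  forall q (u : hom q c), van y u -> van y' (f \o u).
Proof.
elim=> {c c' f y y'} [c c' f s s' g e1 e2|c c' f z z' f' s s' y y' g e1 e2 _ IH] q u /=.
  by case=> v <-; exists (g \o v); rewrite !compA e1.
case=> k [t [v [w [e3 e4 vy]]]]; exists k, t, (g \o v), (f' \o w); split.
- by rewrite compA e1 -!compA e3.
- by rewrite compA e2 -!compA e4.
- exact: IH.
Qed.

(* The two liftings of [u] to the first middle term of [y'], through [y] and
   through the witness of [van y' (f \o u)], differ by a map [r] to [z'];
   refining the witness makes [r] lift one step further, and then its
   contribution to the class vanishes. *)
Lemma van_ymorV d c c' (f : hom c c') (y : yon d c) y' : ymor (idm d) f y y' ->
  forall q (u : hom q c), van y' (f \o u) -> van y u.
Proof.
elim=> {c c' f y y'} [c c' f s s' g e1 e2|c c' f z z' f' s s' y y' g e1 e2 _ IH] q u /=.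
  rewrite compm1 in e2.
  (* The corrected lift [w - (inc s \o r)] lives on the cover [t]. Its images under [prj s] and [g]
     both factor through [t], so it kills the kernel of [t] and descends to [q]. *)
  case=> v vE; have [q1 [t [w [et wE]]]] := epi_cover u (@prj_epi _ _ _ s).
  have [|r rE] := @inc_lift _ _ _ s' _ ((g \o w) - (v \o t)).
    by rewrite compBr !compA e1 vE -!compA wE subrr.
  have [_ _ ck] := epi_coker et (kermapP t); have [tk _ _] := kermapP t.
  have p0 : prj s \o (w - (inc s \o r)) = u \o t.
    by rewrite compBr compA prj_inc comp0m subr0.
  have g0 : g \o (w - (inc s \o r)) = v \o t.
    by rewrite compBr compA -e2 rE subKr.
  have [|l lE] := ck _ (w - (inc s \o r)).
    have [|r' r'E] := @inc_lift _ _ _ s _ ((w - (inc s \o r)) \o kermap t).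
      by rewrite compA p0 -compA tk compm0.
    rewrite -r'E (_ : r' = 0) ?compm0 //; apply: (mono_eq0 (@inc_mono _ _ _ s')).
    by rewrite e2 -compA r'E compA g0 -compA tk compm0.
  by exists l; apply: et; rewrite -compA lE.
case=> k [t [v [w [e3 e4 vy]]]].
have [q1 [t1 [w1 [et1 w1E]]]] := epi_cover (u \o prj t) (@prj_epi _ _ _ s).
have [|r rE] := @inc_lift _ _ _ s' _ ((v \o t1) - (g \o w1)).
  by rewrite compBr !compA e3 e1 -!compA w1E !compA subrr.
have [q2 [t2 [w2 [et2 w2E]]]] := epi_cover r (@ytop_epi _ _ y').
have [k3 [t3 [m3 m3E]]] : exists k3 (t3 : ses k3 q) (m : hom (mid t3) q2),
    prj t3 = prj t \o (t1 \o (t2 \o m)).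
  have ep : epi (prj t \o (t1 \o t2)).
    by apply: epi_comp; [apply: epi_comp | apply: prj_epi].
  by exists _, (ses_of_epi ep), (idm _); rewrite compm1.
have m3K x (v0 : hom x (mid t3)) : prj t \o (t1 \o (t2 \o (m3 \o v0))) = prj t3 \o v0.
  by rewrite m3E -!compA.
have [|m mE] := @inc_lift _ _ _ s _ ((w1 \o (t2 \o m3)) \o inc t3).
  by rewrite !compA w1E -!compA m3K prj_inc compm0.
have [|l lE] := @inc_lift _ _ _ t _ ((t1 \o (t2 \o m3)) \o inc t3).
  by rewrite -!compA m3K prj_inc.
exists _, t3, (w1 \o (t2 \o m3)), m; split=> //; first by rewrite compA w1E m3E -!compA.
apply: IH.
have -> : f' \o m = (w \o l) - (r \o ((t2 \o m3) \o inc t3)).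
  apply: (@inc_mono _ _ _ s'); rewrite compBr !compA e2 e4 -!compA mE lE.
  rewrite !compA rE -!compA compBl !compA.
  by rewrite opprB addrC subrK.
apply: vanD; first exact: van_comp.
by apply: vanN; rewrite !compA -w2E -!compA; apply: van_lift.
Qed.

(** Since [yon d c] has extensions of every positive length, this is the vanishing of Ext^n(c, d)
    for all n >= 1. *)
Definition acyc c d := forall y : yon d c, van y (idm c).

Lemma ymor_id d c (y : yon d c) : ymor (idm d) (idm c) y y.
Proof.
elim: y => [c' s|c' z s y IH].
  by apply: (@Mone _ _ _ _ _ _ _ _ (idm _)); rewrite !comp1m !compm1.
by apply: (@Mcons _ _ _ _ _ _ _ _ (idm _) _ _ _ _ (idm _)); rewrite ?comp1m ?compm1.
Qed.

Lemma yon_pull d c q (y : yon d c) (f : hom q c) :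
  exists y' : yon d q, ymor (idm d) f y' y.
Proof.
case: y f => [c' s|c' z s y] f; have [s' [g [g1 g2 _ _]]] := ses_pull s f.
  by exists (Yone s'); apply: (@Mone _ _ _ _ _ _ _ _ g); rewrite ?compm1.
exists (Ycons s' y); apply: (@Mcons _ _ _ _ _ _ _ _ (idm _) _ _ _ _ g); rewrite ?compm1 //.
exact: ymor_id.
Qed.

Lemma acyc_van c d : acyc c d -> forall c' (y : yon d c') (f : hom c c'), van y f.
Proof.
move=> ac c' y f; have [y' m] := yon_pull y f.
by rewrite -[f]compm1; apply: (van_ymor m); apply: ac.
Qed.

Lemma acyc_proj p d : projective p -> acyc p d.
Proof.
move=> pp y; have [g <-] := pp _ _ _ (idm p) (@ytop_epi _ _ y).
exact: van_lift.
Qed.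

(** The innermost sequence starts at [d], so its inclusion has a retraction and its projection a
    section; the outer sequences witness themselves. *)
Lemma acyc_inj c d : injective_ob d -> acyc c d.
Proof.
move=> id y; elim: y => [c' s|c' z s y IH] /=.
  have [r rE] := id _ _ _ (idm d) (@inc_mono _ _ _ s).
  have [|w wE] := @prj_desc _ _ _ s _ (idm _ - (inc s \o r)).
    by rewrite compBl comp1m -compA rE compm1 subrr.
  exists w; apply: (@prj_epi _ _ _ s); rewrite -compA wE compBr compA prj_inc comp0m.
  by rewrite subr0 compm1 comp1m.
by exists _, s, (idm _), (idm _); rewrite !compm1 !comp1m; split.
Qed.

(** * Dimension shifting *)
(** The Yoneda product with [t], that is, the connecting map from Ext^n(c, d) to Ext^(n+1)(c,
    d'). *)
Fixpoint yapp d d' c (y : yon d c) (t : ses d' d) : yon d' c :=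
  match y with
  | Yone _ s => Ycons s (Yone t)
  | Ycons _ _ s y' => Ycons s (yapp y' t)
  end.

(* Exactness of Ext(c, mid t) -> Ext(c, d) -> Ext(c, d') at the middle term. *)
Lemma van_yapp d d' (t : ses d' d) c (y : yon d c) q (f : hom q c) :
  van (yapp y t) f -> exists y' : yon (mid t) q, ymor (prj t) f y' y.
Proof.
elim: y q f => [c' s|c' z s y IH] q f /=.
  case=> k [t' [g [f' [g1 g2 [h hE]]]]].
  (* The pushout of the witness [t'] along the lift [h] of [f'] is the desired extension by
     [mid t]. *)
  have [s' [m [m1 m2 um xm]]] := ses_push t' h.
  have [|l [l1 l2]] := um _ (inc s \o prj t) g; first by rewrite -compA hE g2.
  exists (Yone s'); apply: (@Mone _ _ _ _ _ _ _ _ l) => //.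
  apply: xm; first by rewrite -!compA l1 compA !prj_inc comp0m compm0.
  by rewrite -!compA l2 m1 g1.
case=> k [t' [g [f' [g1 g2 /IH[y' ym]]]]].
by exists (Ycons t' y'); apply: (@Mcons _ _ _ _ _ _ _ _ f' _ _ _ _ g).
Qed.

(** The connecting image of [y] vanishes, so [y] comes from an extension by [mid t], which vanishes
    as well. *)
Lemma acyc_shift2 c d d' (t : ses d' d) : acyc c (mid t) -> acyc c d' -> acyc c d.
Proof.
move=> aw ad y; have [y' m] := van_yapp (ad (yapp y t)).
by rewrite -[idm c]comp1m; apply: (van_ymor m); apply: aw.
Qed.

(* Exactness of Ext(c, a) -> Ext(c, mid t) -> Ext(c, b) at the middle term. *)
Lemma yon_middle a b (t : ses a b) c (y : yon (mid t) c) :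
  exists2 yb : yon b c, ymor (prj t) (idm c) y yb &
  forall q (f : hom q c), van yb f -> exists y' : yon a q, ymor (inc t) f y' y.
Proof.
elim: y => [c' s|c' z s y [yb m IH]].
  have [s' [g [g1 g2 _ _]]] := ses_push s (prj t).
  exists (Yone s'); first by apply: (@Mone _ _ _ _ _ _ _ _ g); rewrite ?comp1m.
  move=> q f [l lE].
  (* The map [g] to the pushout is epi with kernel [a]; pulling it back along the lift [l] of [f]
     gives an extension of [q] by [a]. *)
  have [kg eg] := ses_quot (ses_ker t) (@prj_epi _ _ _ t) g2 g1.
  have [s'' [v [v1 v2 _ _]]] := ses_pull (Ses kg eg) l; rewrite /= in v1 v2 *.
  exists (Yone s''); refine (@Mone _ _ (inc t) _ _ f s'' s v _ _); last by rewrite v2.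
  by rewrite -g1 -compA v1 compA lE.
exists (Ycons s yb).
  apply: (@Mcons _ _ _ _ _ _ _ _ (idm _) _ _ _ _ (idm _)) => //.
    by rewrite comp1m compm1.
  by rewrite comp1m compm1.
move=> q f [k [t' [g [f' [g1 g2 /IH[y' ym]]]]]].
by exists (Ycons t' y'); apply: (@Mcons _ _ _ _ _ _ _ _ f' _ _ _ _ g).
Qed.

Fact bp_ker a b : is_kernel (in1 a b) (pr2 a b).
Proof.
have [h1 _ h2 _ _] := bpP a b; split=> // [x u v uv|x u u0].
  by rewrite -[u]comp1m -h1 -compA uv compA h1 comp1m.
by exists (pr1 a b \o u); rewrite -[RHS]pair_eta u0 /pairm compm0 addr0.
Qed.

Fact pr2_epi a b : epi (pr2 a b).
Proof.
have [_ h _ _ _] := bpP a b.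
by apply: (@epi_compl _ _ _ _ (in2 a b)); rewrite h; apply: epi_id.
Qed.

Lemma acyc_bp2 c a b : acyc c a -> acyc c b -> acyc c (bp a b).
Proof.
move=> aa ab y; have [yb _ H] := @yon_middle a b (Ses (@bp_ker a b) (@pr2_epi a b)) c y.
have [y' m] := H _ _ (ab yb); rewrite -[idm c]comp1m; apply: (van_ymor m); exact: aa.
Qed.

(** The identity is a sum of two maps, one factoring through [a] and the other through [b]. *)
Lemma acyc_bp1 d a b : acyc a d -> acyc b d -> acyc (bp a b) d.
Proof.
move=> aa ab y; have [_ _ _ _ <-] := bpP a b.
by apply: vanD; apply: van_comp; apply: acyc_van.
Qed.

(* Exactness of Ext(mid s0, d) -> Ext(z, d) -> Ext(q, d) at the middle term. *)
Lemma yon_extend d z q (s0 : ses z q) (y : yon d z) :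
  van (Ycons s0 y) (idm q) ->
  exists y' : yon d (mid s0), ymor (idm d) (inc s0) y y'.
Proof.
elim: y q s0 => [z0 s|z0 z' s y IH] q s0.
  case=> z1 [t1 [g [f' [g1 f1 [l lE]]]]]; rewrite comp1m in g1.
  (* The middle term of the pushout [s1] maps onto [mid s0] with kernel [d]; this is the extension
     of [mid s0] that restricts to [s]. *)
  have [s1 [m [m1 m2 um xm]]] := ses_push t1 l.
  have [|b [b1 b2]] := um _ (inc s0 \o prj s) g; first by rewrite -compA lE.
  have [||kb eb] := @ses_quot _ _ _ _ _ s0 s1 _ _ b (ses_ker s) (@prj_epi _ _ _ s).
  - by rewrite b1.
  - apply: (xm _ (prj s0 \o b) (prj s1)); last by rewrite -compA b2 g1 m1.
    by rewrite -compA b1 compA !prj_inc comp0m.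
  exists (Yone (Ses kb eb)).
  refine (@Mone _ _ (idm d) _ _ (inc s0) s (Ses kb eb) (inc s1) _ _) => //=.
  by rewrite compm1.
case=> z1 [t1 [g [f' [g1 f1 [k2 [t2 [g2 [f2 [e1 e2 v]]]]]]]]]; rewrite comp1m in g1.
(* Pulling [s] back along [f'] turns the witness for [f'] into one for the identity, as the
   induction requires. *)
have [s' [h [h1 h2 uh xh]]] := ses_pull s f'.
have [r [r1 r2]] := uh _ _ _ e1.
have [|y' my] := IH _ s'.
  exists k2, t2, r, f2; split=> //; first by rewrite comp1m.
  apply: xh; last by rewrite !compA prj_inc comp0m r2 prj_inc.
  by rewrite !compA h2 r1 e2.
(* The square from [mid s'] to [mid s0] through [mid s] and [mid t1] folds into a short exact
   sequence, onto which [y'] is spliced. *)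
pose i := pairm h (- (inc t1 \o prj s')); pose p := copairm (inc s0 \o prj s) g.
have ki : is_kernel i p.
  split.
  - by rewrite copair_pair compNr -compA h1 !compA f1 subrr.
  - move=> x u u' /[dup] /(congr1 (comp (pr1 _ _))) + /(congr1 (comp (pr2 _ _))).
    rewrite !compA pr1_pair pr2_pair => uv1.
    rewrite !compNl -!compA => /oppr_inj /(@inc_mono _ _ _ t1) uv2; exact: xh.
  move=> x u pu.
  have pu' : (inc s0 \o prj s \o (pr1 _ _ \o u)) + (g \o (pr2 _ _ \o u)) = 0.
    by rewrite -copair_pair pair_eta.
  have [|w wE] := @inc_lift _ _ _ t1 _ (pr2 _ _ \o u).
    rewrite -g1; move/(congr1 (comp (prj s0))): pu'.
    by rewrite compDr !compA prj_inc !comp0m add0r compm0.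
  have [|r' [r1' r2']] := uh _ (pr1 _ _ \o u) (- w).
    apply/eqP; rewrite compNr -subr_eq0 opprK; apply/eqP.
    apply: (mono_eq0 (@inc_mono _ _ _ s0)).
    by rewrite compDr (compA _ f') f1 -(compA g) wE compA.
  exists r'; apply: bp_ext; rewrite compA ?pr1_pair ?pr2_pair //.
  by rewrite compNl -compA r2' compNr opprK.
have ep : epi p.
  apply: epi0 => x u; rewrite copair_comp => up.
  have u1 : u \o inc s0 = 0.
    apply: (epi_eq0 (@prj_epi _ _ _ s)).
    by rewrite -compA -(copair_in1 (u \o (inc s0 \o prj s)) (u \o g)) up comp0m.
  have u2 : u \o g = 0.
    by rewrite -(copair_in2 (u \o (inc s0 \o prj s)) (u \o g)) up comp0m.
  have [w wE] := prj_desc u1; rewrite -wE (_ : w = 0) ?comp0m //.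
  by apply: (epi_eq0 (@prj_epi _ _ _ t1)); rewrite -g1 compA wE.
exists (Ycons (Ses ki ep) y').
refine (@Mcons _ _ (idm d) _ _ (inc s0) _ _ (inc s') s (Ses ki ep) y y'
  (in1 _ _) _ _ my) => /=.
  by rewrite copair_in1.
rewrite pair_comp h2 compNl -compA prj_inc compm0 oppr0 in1_pair pair_comp.
by rewrite comp1m comp0m.
Qed.

(** The obstruction [Ycons s y] vanishes, so [y] is the restriction of an extension of [mid s],
    whose vanishing restricts to that of [y]. *)
Lemma acyc_shift1 z q d (s : ses z q) : acyc (mid s) d -> acyc q d -> acyc z d.
Proof.
move=> ak aq y; have [y' m] := yon_extend (aq (Ycons s y)).
apply: (van_ymorV m); rewrite compm1 -[inc s]comp1m; exact/van_comp/ak.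
Qed.

End Yoneda.

(** * Exactness in terms of generalized elements, and its relation to homology *)

Section Exactness.
Variable A : abelianCat.
Implicit Types a b c d k q x z : A.

(** The second clause is the elementwise form of exactness, preimages being allowed to exist only on
    an epimorphic cover. *)
Definition exact a b c (f : hom a b) (g : hom b c) : Prop :=
  g \o f = 0 /\ forall x (u : hom x b), g \o u = 0 ->
    exists x' (t : hom x' x) (v : hom x' a), epi t /\ f \o v = u \o t.

Lemma exact_zero a b c (f : hom a b) (g : hom b c) : is_zero b -> exact f g.
Proof.
move=> b0; split=> [|x u _]; first by rewrite ((b0 c).1 g) comp0m.
exists x, (idm x), 0; split; first exact: epi_id.
by rewrite compm0 compm1 ((b0 x).2 u).
Qed.

Lemma exact_epi a b c (f : hom a b) (g : hom b c) : g = 0 -> exact f g <-> epi f.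
Proof.
move=> g0; split=> [[_ ex]|ef].
  have [|x [t [v [et tE]]]] := ex _ (idm b); first by rewrite g0 comp0m.
  by apply: (@epi_compl _ _ _ _ v); rewrite tE comp1m.
split=> [|x u _]; first by rewrite g0 comp0m.
by have [x' [t [v [et vE]]]] := epi_cover u ef; exists x', t, v.
Qed.

Lemma exact_mono a b c (f : hom a b) (g : hom b c) : f = 0 -> exact f g -> mono g.
Proof.
move=> f0 [_ ex]; apply: mono0 => x u /ex[x' [t [v [et tE]]]].
by apply: (epi_eq0 et); rewrite -tE f0 comp0m.
Qed.

Lemma exact_factor a b c (f : hom a b) (g : hom b c) k (i : hom k b) :
  exact f g -> is_kernel i g -> exists p, i \o p = f /\ epi p.
Proof.
move=> [gf ex] [gi mi ki]; have [p pE] := ki _ _ gf; exists p; split=> //.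
have [x [t [v [et tE]]]] := ex _ _ gi; apply: (@epi_compl _ _ _ _ v).
suff -> : p \o v = t by [].
by apply: mi; rewrite compA pE.
Qed.

(** Both sides say that [boundary C j] is epi. The neighbouring indices are variables tied by
    equations, so that they may be written in any form. *)
Lemma homology_exact (C : complex A) (i j l : int) : i = j + 1 -> l = j - 1 ->
  is_zero (homology C j) <-> exact (dif C i j) (dif C j l).
Proof.
move=> -> ->; have [zk mk uk] := kermapP (dif C j (j - 1)).
have [zc ec uc] := cokmapP (boundary C j).
have bE : kermap (dif C j (j - 1)) \o boundary C j = dif C (j + 1) j by exact: kerliftK.
split=> [h0|ex].
  have eb : epi (boundary C j).
    apply: epi0 => x g /uc[h <-]; rewrite (_ : cokmap (boundary C j) = 0) ?compm0 //.
    exact: (h0 _).2.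
  split=> [|x u /uk[w wE]]; first exact: difK.
  have [x' [t [v [et vE]]]] := epi_cover w eb.
  by exists x', t, v; rewrite -bE -compA vE compA wE.
have [p [pE ep]] := exact_factor ex (kermapP _).
have eb : epi (boundary C j) by rewrite (_ : boundary C j = p) //; apply: mk; rewrite pE.
have c0 : cokmap (boundary C j) = 0 by apply: (epi_eq0 eb).
have i0 : idm (homology C j) = 0 by apply: ec; rewrite c0 !compm0.
by move=> b; split=> f; [rewrite -[f]compm1 i0 compm0 | rewrite -[f]comp1m i0 comp0m].
Qed.

End Exactness.

(** * Iterated extensions as acyclic complexes *)

Section Realization.
Variable A : abelianCat.
Implicit Types c d z : A.

Section Splice.
Variables (c d z : A) (n : nat) (E : extension n z d) (s : ses z c).

(** The degree 0 term of [E], a copy of [z], disappears in the splice, and the higher terms move up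
    by one. *)
Definition splice_ob (k : int) : A :=
  match k with
  | Posz 0 => c
  | Posz 1 => mid s
  | Posz k.+2 => E (Posz k.+1)
  | Negz _ => zob A
  end.

Definition splice_dif (i j : int) : hom (splice_ob i) (splice_ob j) :=
  match i, j return hom (splice_ob i) (splice_ob j) with
  | Posz 1, Posz 0 => prj s
  | Posz i.+2, Posz 1 => inc s \o ext_right E \o dif E (Posz i.+1) (Posz 0)
  | Posz i.+2, Posz j.+2 => dif E (Posz i.+1) (Posz j.+1)
  | _, _ => 0
  end.

Fact splice_shape i j : i != j + 1 -> splice_dif i j = 0.
Proof.
case: i j => [[|[|i]]|i] [[|[|j]]|j] //= ij; rewrite dif_shape ?compm0 //;
  by apply: contraNneq ij; lia.
Qed.

Fact splice_difK i j k : splice_dif j k \o splice_dif i j = 0.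
Proof.
case: j => [[|[|j]]|j].
- by case: k => [[|[|k]]|k]; rewrite comp0m.
- case: i => [[|[|i]]|i]; rewrite ?compm0 //.
  case: k => [[|[|k]]|k]; rewrite ?comp0m //=.
  by rewrite !compA prj_inc !comp0m.
- case: i => [[|[|i]]|i]; rewrite ?compm0 //.
  by case: k => [[|[|k]]|k]; rewrite ?comp0m //= -?compA difK // !compm0.
- by case: k => [[|[|k]]|k]; rewrite comp0m.
Qed.

Definition splice_complex : complex A := Complex splice_shape splice_difK.

Lemma ext_exact_at (i j l : int) : i = j + 1 -> l = j - 1 ->
  exact (dif E i j) (dif E j l).
Proof. by move=> ei el; apply/(homology_exact _ ei el)/ext_exact. Qed.

Fact splice_exact k : is_zero (homology splice_complex k).
Proof.
case: k => [[|[|[|k]]]|k].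
- apply/(@homology_exact _ _ (Posz 1) _ (Negz 0)) => //; apply/exact_epi => //.
  exact: prj_epi.
- apply/(@homology_exact _ _ (Posz 2) _ (Posz 0)) => //; split; first exact: splice_difK.
  move=> x u /inc_lift[w <-]; have [r [rE1 rE2]] := ext_right_iso E.
  have [_ ex] := @ext_exact_at 1 0 (Negz 0) erefl erefl.
  have [|x' [t [v [et tE]]]] := ex _ (r \o w).
    by rewrite (_ : dif E 0 (Negz 0) = 0) ?comp0m //; apply: (ext_out E _ _).2.
  exists x', t, v; split=> //=.
  by rewrite -!compA tE -!compA (compA _ r) rE2 comp1m.
- apply/(@homology_exact _ _ (Posz 3) _ (Posz 1)) => //; split; first exact: splice_difK.
  have [_ ex] := @ext_exact_at 2 1 0 erefl erefl.
  move=> x u /= u0; apply: ex; apply: (mono_eq0 (iso_mono (ext_right_iso E))).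
  by apply: (mono_eq0 (@inc_mono _ _ _ s)); rewrite !compA.
- apply/(@homology_exact _ _ (Posz k.+4) _ (Posz k.+2)); try lia.
  by apply: ext_exact_at; lia.
apply/(@homology_exact _ _ (Negz k + 1) _ (Negz k - 1)) => //.
exact/exact_zero/zobP.
Qed.

Fact splice_out (k : int) : (k < 0) || (n.+2%:Z < k) -> is_zero (splice_complex k).
Proof.
case: k => [[|[|k]]|k] h; try by lia.
  by apply: ext_out; lia.
exact: zobP.
Qed.

Fact idm_iso (a : A) : is_iso (idm a).
Proof. by exists (idm a); rewrite comp1m. Qed.

Definition splice : extension n.+1 c d :=
  @Extension A n.+1 c d splice_complex splice_exact splice_out (idm c) (idm_iso c)
    (ext_left E) (ext_left_iso E).

End Splice.

Section Trivial.
Variable d : A.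

(** The degenerate 0-fold extension, which lets a single short exact sequence be realized as a
    splice too. *)
Definition ext0_ob (k : int) : A :=
  match k with Posz 0 => d | Posz 1 => d | _ => zob A end.

Definition ext0_dif (i j : int) : hom (ext0_ob i) (ext0_ob j) :=
  match i, j return hom (ext0_ob i) (ext0_ob j) with
  | Posz 1, Posz 0 => idm d
  | _, _ => 0
  end.

Fact ext0_shape i j : i != j + 1 -> ext0_dif i j = 0.
Proof. by case: i j => [[|[|i]]|i] [[|[|j]]|j] //=. Qed.

Fact ext0_difK i j k : ext0_dif j k \o ext0_dif i j = 0.
Proof.
case: j => [[|[|j]]|j].
- by case: k => [[|[|k]]|k]; rewrite comp0m.
- by case: i => [[|[|i]]|i]; rewrite ?compm0.
- by case: i => [[|[|i]]|i]; rewrite ?compm0.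
- by case: k => [[|[|k]]|k]; rewrite comp0m.
Qed.

Definition ext0_complex : complex A := Complex ext0_shape ext0_difK.

Fact ext0_exact k : is_zero (homology ext0_complex k).
Proof.
apply/(@homology_exact _ _ (k + 1) _ (k - 1)) => //.
case: k => [[|[|k]]|k]; try by apply/exact_zero/zobP.
  by apply/exact_epi; [|apply: epi_id].
split=> [|x u]; first exact: ext0_difK.
rewrite /= comp1m => ->; exists x, (idm x), 0.
by rewrite compm0 comp0m; split=> //; apply: epi_id.
Qed.

Fact ext0_out (k : int) : (k < 0) || (1%:Z < k) -> is_zero (ext0_complex k).
Proof. by case: k => [[|[|k]]|k] h; try (by lia); apply: zobP. Qed.

Definition ext0 : extension 0 d d :=
  @Extension A 0 d d ext0_complex ext0_exact ext0_out (idm d) (idm_iso d)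
    (idm d) (idm_iso d).
End Trivial.

Fixpoint realize d c (y : yon d c) : extension (ylen y) c d :=
  match y in yon _ c return extension (ylen y) c d with
  | Yone _ s => splice (ext0 d) s
  | Ycons _ _ s y' => splice (realize y') s
  end.

(* [y] describes the part of [E] in degrees > k, where [z] is identified by
   [i] with the image of E_(k+1) -> E_k. *)
Fixpoint models n c d (E : extension n c d) z (y : yon d z) :
    forall k : nat, hom z (E k) -> Prop :=
  match y in yon _ z return forall k : nat, hom z (E k) -> Prop with
  | Yone _ s => fun k i => exists m : hom (mid s) (E k.+1),
      [/\ is_iso m, i \o prj s = dif E k.+1 k \o m
        & m \o inc s = dif E n.+1 k.+1 \o ext_left E]
  | Ycons _ _ s y' => fun k i => exists m : hom (mid s) (E k.+1),
      [/\ is_iso m, i \o prj s = dif E k.+1 k \o m & @models n c d E _ y' k.+1 (m \o inc s)]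
  end.

Arguments models {n c d} E {z} y {k} i.

Lemma ylen_gt0 d c (y : yon d c) : (0 < ylen y)%N.
Proof. by case: y. Qed.

(** The rungs of the ladder are the components of [f], conjugated by the identifications of the
    middle terms; as [i'] is mono, the squares commute. *)
Lemma models_ymor n c d (E F : extension n c d) (f : chain_map E F) :
  f n.+1 \o ext_left E = ext_left F ->
  forall z (y : yon d z) z' (y' : yon d z') (k : nat) (i : hom z (E k)) (i' : hom z' (F k))
    (u : hom z z'),
  mono i' -> models E y i -> models F y' i' -> ylen y = ylen y' ->
  i' \o u = f k \o i -> ymor (idm d) u y y'.
Proof.
move=> fl z y; elim: y => [c1 s|c1 z1 s y IH] z' [c2 s'|c2 z2 s' y'] k i i' u mi' //=;
  [|by move=> _ _ []; have := ylen_gt0 y'; lia|by move=> _ _ []; have := ylen_gt0 y; lia|].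
  move=> [m [im em lm]] [m' [im' em' lm']] _ iu; have [m1 [m1m mm1]] := im'.
  apply: (@Mone _ _ _ _ _ _ _ _ _ (m1 \o f k.+1 \o m)).
    apply: mi'; rewrite [RHS]compA iu -[RHS]compA em [RHS]compA -cmapE.
    by rewrite !compA em' -!compA (compA m') mm1 comp1m.
  rewrite compm1; apply: (iso_mono im'); rewrite lm' -!compA (compA m') mm1 comp1m.
  by rewrite lm -fl !compA cmapE.
move=> [m [im em my]] [m' [im' em' my']] [el] iu; have [m1 [m1m mm1]] := im'.
have e1 : prj s' \o (m1 \o f k.+1 \o m) = u \o prj s.
  apply: mi'; rewrite [RHS]compA iu -[RHS]compA em [RHS]compA -cmapE.
  by rewrite !compA em' -!compA (compA m') mm1 comp1m.
have [|v vE] := @inc_lift _ _ _ s' _ (m1 \o f k.+1 \o m \o inc s).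
  by rewrite compA e1 -compA prj_inc compm0.
refine (Mcons e1 vE _).
apply: (IH _ _ k.+1 _ _ _ _ my my' el).
  by apply: mono_comp (iso_mono im'); apply: inc_mono.
by rewrite -compA vE !compA mm1 comp1m.
Qed.

(** Cuts [E] at its images: the kernel of [p] is the next image by exactness, until the left end [d]
    is reached at [m = 0]. *)
Lemma models_exist n c d (E : extension n c d) m (k : nat) : (m + k.+1)%N = n ->
  forall z (i : hom z (E k)) (p : hom (E k.+1) z), mono i -> epi p ->
  i \o p = dif E k.+1 k -> exists2 y : yon d z, ylen y = m.+1 & models E y i.
Proof.
elim: m k => [|m IH] k en z i p mi ep ipE.
  have ml : mono (dif E n.+1 k.+1).
    apply: (@exact_mono _ _ _ _ (dif E n.+2 n.+1)).
      by apply: (ext_out E _ _).1; lia.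
    by apply: ext_exact_at; lia.
  have [_ ex] : exact (dif E n.+1 k.+1) (dif E k.+1 k) by apply: ext_exact_at; lia.
  have mdl : mono (dif E n.+1 k.+1 \o ext_left E).
    by apply: mono_comp => //; apply/iso_mono/ext_left_iso.
  have kp : is_kernel (dif E n.+1 k.+1 \o ext_left E) p.
    split=> //; first by apply: (mono_eq0 mi); rewrite !compA ipE difK comp0m.
    move=> x u pu; have [|x' [t [v [et vE]]]] := ex _ u.
      by rewrite -ipE -compA pu compm0.
    have [l [_ lE]] := ext_left_iso E.
    have [|r [rE _]] := @epi_descend _ _ _ _ _ _ _ u (l \o v) et mdl.
      by rewrite -vE -!compA (compA _ l) lE comp1m.
    by exists r.
  exists (Yone (Ses kp ep)) => //=; exists (idm _); split.
  - exact: idm_iso.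
  - by rewrite ipE compm1.
  - by rewrite comp1m.
have [kz km ku] := kermapP p.
have kd : is_kernel (kermap p) (dif E k.+1 k).
  split=> //; first by rewrite -ipE -compA kz compm0.
  by move=> x u; rewrite -ipE -compA => /(mono_eq0 mi)/ku.
have [|q [qE eq]] := @exact_factor _ _ _ _ (dif E k.+2 k.+1) _ _ _ _ kd.
  by apply: ext_exact_at; lia.
have [|y ly my] := IH k.+1 _ _ _ _ km eq qE; first by lia.
exists (Ycons (ses_of_epi ep) y) => /=; first by rewrite ly.
exists (idm _); split; rewrite ?compm1 ?comp1m //; exact: idm_iso.
Qed.

Lemma models_splice n c d z (E : extension n z d) (s : ses z c) x (y : yon d x)
  (k : nat) (i : hom x (E k.+1)) : models E y i -> @models _ _ _ (splice E s) x y k.+2 i.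
Proof. by elim: y k i => [c1 s1|c1 z1 s1 y IH] k i //= [m [im em /IH my]]; exists m. Qed.

Lemma models_cons n c d z (E : extension n z d) (s : ses z c) x (y : yon d x)
  (r : hom x (E 0)) : models E y (k := 0%N) r ->
  @models _ _ _ (splice E s) x y 1%N (inc s \o ext_right E \o r).
Proof.
case: y r => [c1 s1|c1 z1 s1 y] r /= [m [im em h]]; exists m; split=> //.
- by rewrite -!compA em.
- by rewrite -!compA em.
- exact: models_splice.
Qed.

Lemma models_realize d c (y : yon d c) : exists r : hom c (realize y 0),
  [/\ ext_right (realize y) \o r = idm c, r \o ext_right (realize y) = idm _
    & models (realize y) y (k := 0%N) r].
Proof.
elim: y => [c1 s|c1 z s y [r [r1 _ my]]] /=.
  exists (idm c1); rewrite comp1m; split=> //; exists (idm _); split.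
  - exact: idm_iso.
  - by rewrite comp1m compm1.
  - by rewrite comp1m !compm1.
exists (idm c1); rewrite comp1m; split=> //; exists (idm _); split.
- exact: idm_iso.
- by rewrite comp1m compm1.
- by have := models_cons s my; rewrite -compA r1 compm1 comp1m.
Qed.

Lemma realizable n d c (y : yon d c) : ylen y = n ->
  exists (E : extension n c d) (r : hom c (E 0)),
  [/\ ext_right E \o r = idm c, r \o ext_right E = idm _ & models E y (k := 0%N) r].
Proof. by move=> <-; exists (realize y); apply: models_realize. Qed.

Lemma models_full n c d (E : extension n.+1 c d) (r : hom c (E 0)) :
  ext_right E \o r = idm c -> r \o ext_right E = idm _ ->
  exists2 y : yon d c, ylen y = n.+1 & models E y (k := 0%N) r.
Proof.
move=> rE1 rE2; apply: (@models_exist _ _ _ E n 0%N _ _ r (ext_right E \o dif E 1 0)).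
- by rewrite addn1.
- by apply: iso_mono; exists (ext_right E).
- apply: epi_comp; last exact/iso_epi/ext_right_iso.
  apply/(@exact_epi _ _ _ _ _ (dif E 0 (-1))); last exact: ext_exact_at.
  by apply: (ext_out E _ _).2.
- by rewrite compA rE2 comp1m.
Qed.

(** A morphism of extensions yields a ladder between models, along which vanishing passes both ways;
    the rest is induction on the zigzag. *)
Lemma ext_equiv_van n c d (E F : extension n.+1 c d) : ext_equiv E F ->
  forall rE rF (y y' : yon d c),
  ext_right E \o rE = idm c -> rE \o ext_right E = idm _ ->
  ext_right F \o rF = idm c -> rF \o ext_right F = idm _ ->
  ylen y = n.+1 -> ylen y' = n.+1 ->
  models E y (k := 0%N) rE -> models F y' (k := 0%N) rF ->
  van y (idm c) <-> van y' (idm c).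
Proof.
have main (E1 F1 : extension n.+1 c d) rE rF (y y' : yon d c) : ext_morphism E1 F1 ->
    ext_right E1 \o rE = idm c -> ext_right F1 \o rF = idm c ->
    rF \o ext_right F1 = idm _ -> ylen y = n.+1 -> ylen y' = n.+1 ->
    models E1 y (k := 0%N) rE -> models F1 y' (k := 0%N) rF ->
    van y (idm c) <-> van y' (idm c).
  move=> [f [fr fl]] e1 e2 e3 l1 l2 my my'.
  have m : ymor (idm d) (idm c) y y'.
    apply: (models_ymor fl _ my my'); last 2 first.
    - by rewrite l1 l2.
    - rewrite compm1 -[RHS]comp1m -e3 -!compA (compA (ext_right F1)) fr e1 compm1 //.
    by apply: iso_mono; exists (ext_right F1).
  split=> v; first by rewrite -[idm c]comp1m; apply: (van_ymor m).
  by apply: (van_ymorV m); rewrite comp1m.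
elim=> {E F} [E F h|E|E F _ IH|E F G _ IH1 _ IH2] r1 r2 y y' a1 a2 b1 b2 l1 l2 m1 m2.
- exact: (main _ _ _ _ _ _ h a1 b1 b2 l1 l2 m1 m2).
- apply: (main _ _ _ _ _ _ _ a1 b1 b2 l1 l2 m1 m2).
  have cE i j : dif E i j \o idm (E i) = idm (E j) \o dif E i j by rewrite comp1m compm1.
  by exists (ChainMap cE); rewrite /= compm1 comp1m.
- by apply: iff_sym; apply: (IH r2 r1).
(* The intermediate extension of a transitivity step needs a model of its own. *)
have [r [re1 re2]] := ext_right_iso F; have [y1 ly my] := models_full re2 re1.
by apply: (iff_trans (IH1 r1 r y y1 _ _ _ _ _ _ _ _) (IH2 r r2 y1 y' _ _ _ _ _ _ _ _)).
Qed.

(** A representative of the zero class in degree [m.+1]: identity covers followed by a split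
    sequence. *)
Fixpoint yon_trivial d m c : yon d c :=
  match m with
  | 0 => Yone (Ses (@bp_ker A d c) (@pr2_epi A d c))
  | m.+1 => Ycons (ses_of_epi (@epi_id A c)) (yon_trivial d m _)
  end.

Lemma ylen_trivial d m c : ylen (yon_trivial d m c) = m.+1.
Proof. by elim: m c => //= m IH c; rewrite IH. Qed.

Lemma van_trivial d m c : van (yon_trivial d m c) (idm c).
Proof.
have [g <-] : exists g, projT2 (ytop (yon_trivial d m c)) \o g = idm c.
  case: m => [|m] /=; last by exists (idm c); rewrite compm1.
  by exists (in2 d c); have [_ h _ _ _] := bpP d c.
exact: van_lift.
Qed.

(** Realized as complexes, [y] and the trivial extension of the same length are equivalent, and the
    latter vanishes. *)
Lemma Ext_vanishes_acyc c d : (forall n, (1 <= n)%N -> Ext_vanishes n c d) -> acyc c d.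
Proof.
move=> ext y; have [m ly] : exists m, ylen y = m.+1.
  by exists (ylen y).-1; rewrite prednK // ylen_gt0.
have [E [r [r1 r2 my]]] := realizable ly.
have [F [r' [r1' r2' my']]] := realizable (ylen_trivial d m c).
apply/(ext_equiv_van (ext _ _ E F) r1 r2 r1' r2' ly (ylen_trivial d m c) my my') => //.
exact: van_trivial.
Qed.

End Realization.

(** * Acyclicity and resolutions *)

Section Acyclic.
Variable A : abelianCat.
Implicit Types a b c d k q x z : A.

Lemma zero_projective a : is_zero a -> projective a.
Proof. by move=> a0 b c e f _; exists 0; rewrite compm0 ((a0 c).1 f). Qed.

Lemma zero_injective a : is_zero a -> injective_ob a.
Proof. by move=> a0 b c m f _; exists 0; rewrite comp0m ((a0 b).2 f). Qed.

Lemma mono_zero a b (m : hom a b) : mono m -> is_zero b -> is_zero a.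
Proof.
move=> mm b0; have e : idm a = 0.
  by apply: (mono_eq0 mm); apply: (b0 _).2.
by move=> x; split=> f; [rewrite -[f]compm1 e compm0 | rewrite -[f]comp1m e comp0m].
Qed.

Lemma exact_ker_ses a b c (f : hom a b) (g : hom b c) : exact f g ->
  exists p : hom a (kerob g), is_kernel (kermap f) p /\ epi p.
Proof.
move=> ex; have [p [pE ep]] := exact_factor ex (kermapP g); exists p; split=> //.
have [_ mg _] := kermapP g; have [f0 mf uf] := kermapP f; split=> //.
  by apply: (mono_eq0 mg); rewrite compA pE.
by move=> x u pu; apply: uf; rewrite -pE -compA pu compm0.
Qed.

Lemma acyc_ker2 c a b e (f : hom a b) (g : hom b e) :
  exact f g -> acyc c a -> acyc c (kerob f) -> acyc c (kerob g).
Proof. by move=> /exact_ker_ses[p [kp ep]]; apply: (@acyc_shift2 _ _ _ _ (Ses kp ep)). Qed.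

Lemma acyc_ker1 d a b e (f : hom a b) (g : hom b e) :
  exact f g -> acyc a d -> acyc (kerob g) d -> acyc (kerob f) d.
Proof. by move=> /exact_ker_ses[p [kp ep]]; apply: (@acyc_shift1 _ _ _ _ (Ses kp ep)). Qed.

(** The pushout of [s] along [f] splits because Ext^1(q, d) = 0; a retraction onto [d] gives the
    extension of [f]. *)
Lemma acyc_extend z q d (s : ses z q) (f : hom z d) :
  acyc q d -> exists g, g \o inc s = f.
Proof.
move=> aq; have [s' [g [g1 g2 _ _]]] := ses_push s f.
have [h hE] := aq (Yone s').
have [|r rE] := @inc_lift _ _ _ s' _ (idm _ - (h \o prj s')).
  by rewrite compBr compm1 compA hE comp1m subrr.
exists (r \o g); rewrite -compA -g2 compA (_ : r \o inc s' = idm d) ?comp1m //.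
apply: (@inc_mono _ _ _ s'); rewrite compA rE compBl -compA prj_inc compm0 subr0.
by rewrite comp1m compm1.
Qed.

Lemma acyc_lift d w c (s : ses d w) (f : hom c w) :
  acyc c d -> exists g, prj s \o g = f.
Proof.
move=> ac; have [s' [g [g1 g2 _ _]]] := ses_pull s f.
by have [h hE] := ac (Yone s'); exists (g \o h); rewrite compA g1 -compA hE compm1.
Qed.

(** The map [q] from [a] to the kernel of [p] must be epi. If [u] kills it, the cokernel of the
    subobject [kerob u] of [b] kills [f], so it factors through [p]; hence [kerob u] is all of
    [kerob p], and [u] is zero. *)
Lemma coker_exact a b c (f : hom a b) (p : hom b c) : is_cokernel p f -> exact f p.
Proof.
move=> [pf ep up]; have [pi mi ui] := kermapP p.
have [q qE] := ui _ _ pf.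
suff eq : epi q.
  split=> // x u /ui[v <-]; have [x' [t [w [et wE]]]] := epi_cover v eq.
  by exists x', t, w; rewrite -qE -compA wE compA.
apply: epi0 => x u uq; have [uj mj lj] := kermapP u.
have [q' q'E] := lj _ _ uq.
have mij : mono (kermap p \o kermap u) by apply: mono_comp.
have ck := cokmapP (kermap p \o kermap u).
have [_ _ kij] := mono_ker mij ck; have [c0 _ _] := ck.
have [|r rE] := up _ (cokmap (kermap p \o kermap u)).
  by rewrite -qE -q'E (compA (kermap p)) compA c0 comp0m.
have [|s sE] := kij _ (kermap p); first by rewrite -rE -compA pi compm0.
have js : kermap u \o s = idm _ by apply: mi; rewrite compA sE compm1.
by rewrite -[u]compm1 -js compA uj comp0m.
Qed.

(** * Hom keeps one-sided bounded exact complexes of acyclic objects exact *)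

Section ExactHom.
Variables (K : nat -> A).

Lemma exact_homL (D : forall n, hom (K n.+1) (K n)) d :
  epi (D 0%N) -> (forall n, exact (D n.+1) (D n)) -> (forall n, acyc (K n) d) ->
  forall n (f : hom (K n.+1) d), f \o D n.+1 = 0 -> exists g, g \o D n = f.
Proof.
move=> eD ex aK n f fD.
(* Here [b] is the image of [D n]. It is all of [K 0] at the start; afterwards it is the kernel of
   the previous [p], and dimension shifting keeps it acyclic. *)
have : exists b (p : hom (K n.+1) b) (i : hom b (K n)),
    [/\ epi p, i \o p = D n, mono i, acyc b d &
      forall f : hom b d, exists g, g \o i = f].
  elim: {f fD} n => [|n [b [p [i [ep pE mi ab eb]]]]].
    exists (K 0%N), (D 0%N), (idm _); split; rewrite ?comp1m //; first exact: mono_id.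
    by move=> f; exists f; rewrite compm1.
  have [pk mk uk] := kermapP p.
  have kD : is_kernel (kermap p) (D n).
    split=> //; first by rewrite -pE -compA pk compm0.
    by move=> x u; rewrite -pE -compA => /(mono_eq0 mi)/uk.
  have [q [qE eq]] := exact_factor (ex n) kD.
  exists (kerob p), q, (kermap p); split=> //.
    exact: (@acyc_shift1 _ _ _ _ (ses_of_epi ep) (aK _) ab).
  by move=> f; apply: (acyc_extend (ses_of_epi ep)).
move=> [b [p [i [ep pE mi ab eb]]]].
have [_ exD] := ex n.
have [pk _ _] := kermapP p.
have [_ _ cp] := epi_coker ep (kermapP p).
have [|f' f'E] := cp _ f.
  have [|x [t [v [et vE]]]] := exD _ (kermap p); first by rewrite -pE -compA pk compm0.
  by apply: (epi_eq0 et); rewrite -compA -vE compA fD comp0m.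
by have [g gE] := eb f'; exists g; rewrite -pE compA gE.
Qed.

Lemma exact_homR (D : forall n, hom (K n) (K n.+1)) c :
  mono (D 0%N) -> (forall n, exact (D n) (D n.+1)) -> (forall n, acyc c (K n)) ->
  forall n (f : hom c (K n.+1)), D n.+1 \o f = 0 -> exists g, D n \o g = f.
Proof.
move=> mD ex aK n f fD.
have ker m b (p : hom (K m) b) (i : hom b (K m.+1)) :
    epi p -> i \o p = D m -> mono i -> is_kernel i (D m.+1).
  move=> ep pE mi; have [D0 exD] := ex m.
  split=> //; first by apply: (epi_eq0 ep); rewrite -compA pE.
  move=> x u /exD[x' [t [v [et vE]]]].
  have [|r [rE _]] := @epi_descend _ _ _ _ _ t i u (p \o v) et mi.
    by rewrite -vE compA pE.
  by exists r.
(* Again [b] is the image of [D n], starting from [K 0]; each new image is the quotient of a term by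
   the previous one. *)
have : exists b (p : hom (K n) b) (i : hom b (K n.+1)),
    [/\ epi p, i \o p = D n, mono i, acyc c b &
      forall f : hom c b, exists g, p \o g = f].
  elim: {f fD} n => [|n [b [p [i [ep pE mi ab lb]]]]].
    exists (K 0%N), (idm _), (D 0%N); split; rewrite ?compm1 //; first exact: epi_id.
    by move=> f; exists f; rewrite comp1m.
  have [_ _ ui] := ker _ _ _ _ ep pE mi; have [D0 _ _] := ker _ _ _ _ ep pE mi.
  have [dk mk uk] := kermapP (D n.+2).
  have [q [qE eq]] := exact_factor (ex n.+1) (kermapP (D n.+2)).
  have ki : is_kernel i q.
    split=> //; first by apply: (mono_eq0 mk); rewrite compA qE.
    by move=> x u qu; apply: ui; rewrite -qE -compA qu compm0.
  exists _, q, (kermap (D n.+2)); split=> //.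
    exact: (@acyc_shift2 _ _ _ _ (Ses ki eq) (aK _) ab).
  by move=> f; apply: (acyc_lift (Ses ki eq)).
move=> [b [p [i [ep pE mi ab lb]]]].
have [_ _ ui] := ker _ _ _ _ ep pE mi; have [f' <-] := ui _ _ fD.
by have [g <-] := lb f'; exists g; rewrite -pE compA.
Qed.

End ExactHom.

Section Res.
Variables (C : A -> Prop) (M : A) (R : resolution C M).

Lemma res_exact (i j l : int) : 0 < j -> i = j + 1 -> l = j - 1 ->
  exact (dif R i j) (dif R j l).
Proof. by move=> j0 ei el; apply/(homology_exact _ ei el)/res_acyclic. Qed.

Lemma res_lift_iso : kerlift (res_d0 R) \o kermap (dif R 0 (0 - 1)) = idm _.
Proof.
have [_ mk _] := kermapP (dif R 0 (0 - 1)).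
by apply: mk; rewrite compA kerliftK comp1m compm1.
Qed.

Lemma res_aug_epi : epi (res_aug R).
Proof.
apply: (epi_comp (g := res_H0 R \o cokmap (boundary R 0))).
  apply: (@epi_compl _ _ _ _ (kermap (dif R 0 (0 - 1)))).
  by rewrite res_lift_iso; apply: epi_id.
apply: epi_comp; last exact/iso_epi/res_H0_iso.
by have [] := cokmapP (boundary R 0).
Qed.

Lemma res_aug_exact : exact (dif R 1 0) (res_aug R).
Proof.
split=> [|x u]; first exact: res_aug_d.
rewrite -!compA => /(mono_eq0 (iso_mono (res_H0_iso R))) u0.
have [_ /(_ _ _ u0)[x' [t [v [et vE]]]]] := coker_exact (cokmapP (boundary R 0)).
exists x', t, v; split=> //.
have -> : dif R 1 0 = kermap (dif R 0 (0 - 1)) \o boundary R 0 by rewrite kerliftK.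
by rewrite -compA vE !compA kerliftK comp1m.
Qed.

(** Cycles beyond the bound are zero. Shifting in the second variable goes down to the cycles in
    degree 1, the kernel of the augmentation and [M]. *)
Lemma acyc_res_hat c : (forall w, C w -> acyc c w) -> bounded_resolution R -> acyc c M.
Proof.
move=> aC [b bE].
(* The induction is on [k], a bound for the distance from degree [n] to the zero part of the
   resolution. *)
have aZ (k : nat) (n l : int) : b < n + k%:Z -> 0 < n -> l = n - 1 ->
    acyc c (kerob (dif R n l)).
  elim: k n l => [|k IH] n l bn n0 ln.
    apply: acyc_inj; apply: zero_injective.
    have [_ mk _] := kermapP (dif R n l); apply: (mono_zero mk); apply: bE; lia.
  apply: (@acyc_ker2 _ _ _ _ (dif R (n + 1) n)); first exact: res_exact.
    exact: (aC _ (res_in R _)).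
  by apply: IH; lia.
have aK : acyc c (kerob (res_aug R)).
  apply: (acyc_ker2 res_aug_exact); first exact: (aC _ (res_in R _)).
  by apply: (aZ `|b|%N) => //; lia.
by apply: (@acyc_shift2 _ _ _ _ (ses_of_epi res_aug_epi)) => //; exact: (aC _ (res_in R _)).
Qed.

End Res.

Section Cores.
Variables (C : A -> Prop) (N : A) (R : coresolution C N).

Lemma cores_exact (i j l : int) : j < 0 -> i = j + 1 -> l = j - 1 ->
  exact (dif R i j) (dif R j l).
Proof. by move=> j0 ei el; apply/(homology_exact _ ei el)/cores_acyclic. Qed.

Lemma cores_aug_ker : is_kernel (cores_aug R) (dif R 0 (-1)).
Proof.
have [kd mk uk] := kermapP (dif R 0 (0 - 1)).
have [_ ec _] := cokmapP (boundary R 0).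
have m : mono (cokdesc (cores_d0 R)).
  apply: mono0 => x u u0; have [x' [t [v [et vE]]]] := epi_cover u ec.
  apply: (epi_eq0 et); rewrite -vE (_ : v = 0) ?compm0 //.
  by apply: (mono_eq0 mk); rewrite -(cokdescK (cores_d0 R)) -compA vE compA u0 comp0m.
split; first exact: cores_aug_d.
  by apply: mono_comp m; apply/iso_mono/cores_H0_iso.
move=> x u /uk[v vE]; have [r [_ rE]] := cores_H0_iso R.
exists (r \o (cokmap (boundary R 0) \o v)).
by rewrite -!compA (compA _ r) rE comp1m compA cokdescK.
Qed.

(** Dually, shifting in the first variable goes up from the zero cycles to those in degree -1, and
    then to [N]. *)
Lemma acyc_cores_hat d : (forall v, C v -> acyc v d) -> bounded_coresolution R -> acyc N d.
Proof.
move=> aC [b bE].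
have aZ (k : nat) (n l : int) : n < b + k%:Z -> n < 0 -> l = n - 1 ->
    acyc (kerob (dif R n l)) d.
  elim: k n l => [|k IH] n l bn n0 ln.
    apply: acyc_proj; apply: zero_projective.
    have [_ mk _] := kermapP (dif R n l); apply: (mono_zero mk); apply: bE; lia.
  apply: (@acyc_ker1 _ _ _ _ _ (dif R l (l - 1))).
  - by apply: cores_exact; lia.
  - exact: (aC _ (cores_in R _)).
  by apply: IH; lia.
have [k0 mk uk] := cores_aug_ker.
have [p [kp ep]] : exists p : hom (R 0) (kerob (dif R (-1) (- 2))),
    is_kernel (cores_aug R) p /\ epi p.
  have [|p [pE ep]] := @exact_factor _ _ _ _ (dif R 0 (-1)) _ _ _ _
      (kermapP (dif R (-1) (- 2))).
    by apply: cores_exact; lia.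
  have [_ mk' _] := kermapP (dif R (-1) (- 2)).
  exists p; split=> //; split=> //; first by apply: (mono_eq0 mk'); rewrite compA pE.
  by move=> x u pu; apply: uk; rewrite -pE -compA pu compm0.
apply: (@acyc_shift1 _ _ _ _ (Ses kp ep)); first exact: (aC _ (cores_in R _)).
by apply: (aZ `|b|%N) => //; lia.
Qed.

End Cores.

Lemma orthogonal_acyc (C D : A -> Prop) c d : Ext_orthogonal C D -> C c -> D d -> acyc c d.
Proof. by move=> CD Cc Dd; apply: Ext_vanishes_acyc => n n0; apply: CD. Qed.

End Acyclic.

(** * Comparison maps *)

Section AbBijective.
Variables (K L : abcomplex) (f : abmap K L) (n : int).

(** Phrased with cycles and boundaries, so that the cone arguments never meet a quotient. *)
Lemma abHmap_bij :
  (forall (x : K n) (y : L (n + 1)), abd K n (n - 1) x = 0 ->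
     f n x = abd L (n + 1) n y -> exists x', abd K (n + 1) n x' = x) ->
  (forall y : L n, abd L n (n - 1) y = 0 ->
     exists x y', abd K n (n - 1) x = 0 /\ f n x = y + abd L (n + 1) n y') ->
  bijective (abHmap f n).
Proof.
move=> inj surj.
have Iinj : injective (abHmap f n).
  move=> h1 h2; rewrite -[h1]reprK -[h2]reprK !abHmap_pi => /eqP.
  rewrite -Quotient.idealrBE => /asboolP[y yE]; apply/eqP.
  rewrite -Quotient.idealrBE; apply/asboolP.
  apply: (inj _ y); last by rewrite yE !raddfB.
  by apply/eqP; have := valP (repr h1 - repr h2); rewrite unfold_in.
have Isurj h : exists g, abHmap f n g = h.
  rewrite -[h]reprK; have := valP (repr h); rewrite unfold_in => /eqP hz.
  have [x [y' [xz xE]]] := surj _ hz.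
  have xz' : x \in abcycle K n by rewrite unfold_in xz.
  exists (\pi_(abH K n)%qT (Sub x xz')); rewrite abHmap_pi; apply/eqP.
  rewrite -Quotient.idealrBE; apply/asboolP; exists y'.
  rewrite raddfB /= xE; move: (abd L _ _ y') => w.
  by rewrite [RHS]addrC addKr.
exists (fun h => sval (cid (Isurj h))) => [g|h]; last by case: cid.
by apply: Iinj; case: cid.
Qed.

End AbBijective.

(** * The cone of [P -> R] and the comparison map in the first variable *)

Section ConeXA.
Variables (A : abelianCat) (X : A -> Prop) (M N : A).
Variables (P : resolution (@projective A) M) (R : resolution X M).
Variables (phi : chain_map P R).
Hypothesis phiE : lifts_id phi.
Hypothesis aX : forall c, X c -> acyc c N.

(* The mapping cone of [phi] in degree [k], with the P-component
   in degree [k - 1]. *)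
Definition coneL (k : nat) : A :=
  match k with 0 => R 0 | k.+1 => bp (P k) (R k.+1) end.

Definition coneL_dif (k : nat) : hom (coneL k.+1) (coneL k) :=
  match k with
  | 0 => copairm (phi 0) (dif R 1 0)
  | k.+1 => pairm (- (dif P k.+1 k \o pr1 _ _)) (copairm (phi k.+1) (dif R k.+2 k.+1))
  end.

(** The inclusion of [R] as a subcomplex of the cone. *)
Definition coneL_in (k : nat) : hom (R k) (coneL k) :=
  match k with 0 => idm (R 0) | k.+1 => in2 (P k) (R k.+1) end.

Lemma coneL_dif_in2 (k : nat) : coneL_dif k \o in2 (P k) (R k.+1) = coneL_in k \o dif R k.+1 k.
Proof.
case: k => [|k] /=; first by rewrite copair_in2 comp1m.
rewrite pair_comp copair_in2 compNl -compA; have [_ _ _ -> _] := bpP (P k.+1) (R k.+2).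
by rewrite compm0 oppr0 in2_pair pair_comp comp0m comp1m.
Qed.

(** Once [p] lifts to [v], the sum of [r] and [phi] of [v] is a cycle of [R] in positive degree,
    hence lifts. The lift of [p] enters negatively because of the sign in [coneL_dif]. *)
Lemma coneL_lift (k : nat) x (p : hom x (P k)) (r : hom x (R k.+1)) :
  (phi k \o p) + (dif R k.+1 k \o r) = 0 ->
  (exists x' (t : hom x' x) v, epi t /\ dif P k.+1 k \o v = p \o t) ->
  exists x' (t : hom x' x) v, epi t /\ coneL_dif k.+1 \o v = pairm p r \o t.
Proof.
move=> pr [x1 [t [v [et vE]]]].
have [_ ex] : exact (dif R k.+2 k.+1) (dif R k.+1 k) by apply: res_exact; lia.
have [|x2 [t2 [w [et2 wE]]]] := ex _ ((r \o t) + (phi k.+1 \o v)).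
  by rewrite compDr !compA cmapE -(compA (phi k)) vE compA -compDl addrC pr comp0m.
exists x2, (t \o t2), (pairm (- (v \o t2)) w); split; first exact: epi_comp.
rewrite /= pair_comp copair_pair compNl -compA pr1_pair !compNr opprK.
rewrite pair_comp; congr pairm; first by rewrite !compA vE.
by rewrite wE compDl !compA addrC addrK.
Qed.

Lemma coneL_exact (k : nat) : exact (coneL_dif k.+1) (coneL_dif k).
Proof.
have d0 : coneL_dif k \o coneL_dif k.+1 = 0.
  case: k => [|k] /=.
    rewrite copair_pair copair_comp compNr compA -cmapE difK /copairm comp0m addr0.
    by rewrite addrC -compA subrr.
  rewrite pair_comp copair_pair copair_comp difK compNl -!compA pr1_pair.
  rewrite !compNr opprK !compA difK comp0m -cmapE /copairm comp0m addr0 addNr.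
  by rewrite /pairm !compm0 addr0.
split=> // x u; rewrite -[u]pair_eta; move: (pr1 _ _ \o u) (pr2 _ _ \o u) => {u} p r.
case: k d0 p r => [|k] _ p r /=.
  rewrite copair_pair => pr; apply: coneL_lift => //.
  (* [P] need not be exact at [P 0], but [p] is killed by the augmentation, which [phi] respects. *)
  have [_ ex] := res_aug_exact P; apply: ex.
  have : res_aug R \o ((phi 0 \o p) + (dif R 1 0 \o r)) = 0 by rewrite pr compm0.
  by rewrite compDr !compA phiE res_aug_d comp0m addr0.
rewrite pair_comp copair_pair compNl -compA pr1_pair => e.
have := congr1 (comp (pr1 _ _)) e; rewrite pr1_pair compm0 => /eqP.
rewrite oppr_eq0 => /eqP p0.
have := congr1 (comp (pr2 _ _)) e; rewrite pr2_pair compm0 => pr.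
apply: coneL_lift => //.
by have [_ ex] : exact (dif P k.+2 k.+1) (dif P k.+1 k); [apply: res_exact; lia | apply: ex].
Qed.

(** Locally an element of [R 0] has the same image in [M] as one from [P 0]; their difference is a
    boundary of [R]. *)
Lemma coneL_epi : epi (coneL_dif 0).
Proof.
have [x [t [w [et wE]]]] := epi_cover (res_aug R) (@res_aug_epi _ _ _ P).
have [_ ex] := res_aug_exact R.
have [|x2 [t2 [v [et2 vE]]]] := ex _ (t - (phi 0 \o w)).
  by rewrite compBr compA phiE wE subrr.
apply: (@epi_compl _ _ _ _ (pairm (w \o t2) v)); rewrite copair_pair vE compBl !compA.
by rewrite addrC subrK; apply: epi_comp.
Qed.

Lemma coneL_hom (k : nat) (f : hom (coneL k.+1) N) : f \o coneL_dif k.+1 = 0 ->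
  exists g, g \o coneL_dif k = f.
Proof.
apply: exact_homL; [exact: coneL_epi | exact: coneL_exact |].
case=> [|m] /=; first exact: (aX (res_in R _)).
apply: acyc_bp1; last exact: (aX (res_in R _)).
exact/acyc_proj/(res_in P).
Qed.

(** The hypotheses make [copairm y x] a cocycle on the cone; a primitive of it, restricted to [R],
    is [x']. In degree 0, [x] kills the epimorphism [coneL_dif 0]. *)
Lemma kappaXA_inj (i j l : int) : i = j + 1 -> l = j - 1 ->
  forall (x : hom (R j) N) (y : hom (P l) N), x \o dif R i j = 0 ->
  x \o phi j = y \o dif P j l -> exists x' : hom (R l) N, x' \o dif R j l = x.
Proof.
move=> ->; case: j => [[|k]|k] el x y x0 xy.
- have x00 : x = 0.
    apply: (epi_eq0 coneL_epi); rewrite copair_comp x0 xy.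
    rewrite (_ : dif P 0 l = 0) ?compm0 /copairm ?comp0m ?addr0 //.
    by apply: (res_neg P _ _).2; lia.
  by exists 0; rewrite comp0m x00.
- have el' : l = k by rewrite el; lia.
  move: y xy; rewrite {el}el' => y xy.
  rewrite (_ : Posz k.+1 + 1 = k.+2) in x0; last by lia.
  have [|g gE] := @coneL_hom k (copairm y x).
    rewrite /= copair_pair copair_comp x0 compNr compA -xy /copairm comp0m addr0.
    by rewrite -compA addNr.
  by exists (g \o coneL_in k); rewrite -compA -coneL_dif_in2 compA gE copair_in2.
by exists 0; rewrite comp0m; apply/esym/(res_neg R _ _).1.
Qed.

(** A primitive of the cocycle [copairm y 0] has components [x] on [R] and [y'] on [P]. *)
Lemma kappaXA_surj (i j l : int) : i = j + 1 -> l = j - 1 ->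
  forall y : hom (P j) N, y \o dif P i j = 0 ->
  exists (x : hom (R j) N) (y' : hom (P l) N),
    x \o dif R i j = 0 /\ x \o phi j = y + (y' \o dif P j l).
Proof.
move=> ei; case: j ei => [k|k] ei el y y0; last first.
  exists 0, 0; rewrite !comp0m addr0; split=> //.
  by apply/esym/(res_neg P _ _).1.
have ei' : i = k.+1 by rewrite ei; lia.
rewrite {ei}ei' in y0 *.
have [|g gE] := @coneL_hom k (copairm y 0).
  by rewrite /= copair_pair comp0m addr0 compNr compA y0 comp0m oppr0.
have gR : g \o coneL_in k \o dif R k.+1 k = 0.
  by rewrite -compA -coneL_dif_in2 compA gE copair_in2.
have := copair_in1 y (0 : hom (R k.+1) N); rewrite -gE.
case: k el y y0 g gE gR => [|k] el y y0 g gE gR /=.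
  rewrite -compA copair_in1 => gy.
  by exists g, 0; rewrite comp0m addr0 gy -gR compm1.
have el' : l = k by rewrite el; lia.
rewrite {el}el' -compA pair_comp copair_in1 compNl -compA.
have [-> _ _ _ _] := bpP (P k.+1) (R k.+2); rewrite compm1 => gy.
exists (g \o in2 _ _), (g \o in1 _ _); split=> //.
by rewrite -gy /pairm compDr !compNr !compA [RHS]addrC addNKr.
Qed.

Lemma kappaXA_bij n : bijective (kappaXA phi N n).
Proof.
apply: abHmap_bij => /= [x y|y]; rewrite /precomp.
  by apply: kappaXA_inj; lia.
by apply: kappaXA_surj; lia.
Qed.

End ConeXA.

(** * The cone of [R -> I] and the comparison map in the second variable *)

Section ConeAY.
Variables (A : abelianCat) (Y : A -> Prop) (M N : A).
Variables (R : coresolution Y N) (I : coresolution (@injective_ob A) N).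
Variables (phi : chain_map R I).
Hypothesis phiE : extends_id phi.
Hypothesis aY : forall c, Y c -> acyc M c.

Local Notation "n %:C" := (- (n%:Z)) (at level 2, format "n %:C").

(* The mapping cone of [phi], with coresolutions indexed by degree [- k]. *)
Definition coneR (k : nat) : A :=
  match k with 0 => R 0%:C | k.+1 => bp (R k.+1%:C) (I k%:C) end.

Definition coneR_dif (k : nat) : hom (coneR k) (coneR k.+1) :=
  match k with
  | 0 => pairm (dif R 0%:C 1%:C) (phi 0%:C)
  | k.+1 => pairm (dif R k.+1%:C k.+2%:C \o pr1 _ _)
              (copairm (phi k.+1%:C) (- dif I k%:C k.+1%:C))
  end.

Definition coneR_pr (k : nat) : hom (coneR k) (R k%:C) :=
  match k with 0 => idm (R 0%:C) | k.+1 => pr1 (R k.+1%:C) (I k%:C) end.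

Lemma coneR_pr1_dif (k : nat) : pr1 _ _ \o coneR_dif k = dif R k%:C k.+1%:C \o coneR_pr k.
Proof. by case: k => [|k] /=; rewrite pr1_pair ?compm1. Qed.

(** Lifts the [R]-component alone; the error left in [I] is a cycle, to be removed differently in
    degree 0 and beyond. *)
Lemma coneR_lift (k : nat) x (r : hom x (R k.+1%:C)) (i : hom x (I k%:C)) :
  dif R k.+1%:C k.+2%:C \o r = 0 -> phi k.+1%:C \o r = dif I k%:C k.+1%:C \o i ->
  exists x' (t : hom x' x) v, [/\ epi t, dif R k%:C k.+1%:C \o v = r \o t
    & dif I k%:C k.+1%:C \o ((i \o t) - (phi k%:C \o v)) = 0].
Proof.
move=> r0 ri; have [_ ex] : exact (dif R k%:C k.+1%:C) (dif R k.+1%:C k.+2%:C).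
  by apply: cores_exact; lia.
have [x' [t [v [et vE]]]] := ex _ _ r0; exists x', t, v; split=> //.
by rewrite compBr !compA -ri cmapE -!compA vE subrr.
Qed.

Lemma coneR_exact (k : nat) : exact (coneR_dif k) (coneR_dif k.+1).
Proof.
split.
  case: k => [|k] /=.
    rewrite pair_comp -compA pr1_pair difK copair_pair compNl cmapE subrr.
    by rewrite /pairm !compm0 addr0.
  rewrite pair_comp -compA pr1_pair compA difK comp0m copair_pair.
  rewrite compNl copair_comp compNr difK oppr0 compA -cmapE.
  rewrite /copairm comp0m addr0 subrr.
  by rewrite /pairm !compm0 addr0.
move=> x u; rewrite -[u]pair_eta; move: (pr1 _ _ \o u) (pr2 _ _ \o u) => {u} r i.
rewrite /= pair_comp -compA pr1_pair copair_pair compNl => e.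
have := congr1 (comp (pr1 _ _)) e; rewrite pr1_pair compm0 => r0.
have := congr1 (comp (pr2 _ _)) e; rewrite pr2_pair compm0 => /eqP.
rewrite subr_eq0 => /eqP ri.
have [x1 [t [v [et vE iE]]]] := coneR_lift r0 ri.
case: k r i e r0 ri v vE iE => [|k] r i e r0 ri v vE iE /=.
  (* In degree 0 the error comes from a map [w] to [N]; adding its image in [R 0] to [v] absorbs it,
     as [phi] extends the identity. *)
  have [_ _ kI] := cores_aug_ker I; have [w wE] := kI _ _ iE.
  exists x1, t, (v + (cores_aug R \o w)); split=> //.
  rewrite !pair_comp; congr pairm.
    rewrite compDr vE compA; have [-> _ _] := cores_aug_ker R.
    by rewrite comp0m addr0.
  by rewrite compDr compA phiE wE addrC subrK.
have [_ ex] : exact (dif I k%:C k.+1%:C) (dif I k.+1%:C k.+2%:C).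
  by apply: cores_exact; lia.
have [x2 [t2 [w [et2 wE]]]] := ex _ _ iE.
exists x2, (t \o t2), (pairm (v \o t2) (- w)); split; first exact: epi_comp.
rewrite !pair_comp copair_pair -compA pr1_pair; congr pairm.
  by rewrite !compA vE.
by rewrite compNl compNr opprK wE compBl !compA addrC subrK.
Qed.

Lemma coneR_mono : mono (coneR_dif 0).
Proof.
have [_ mI _] := cores_aug_ker I; have [_ _ kR] := cores_aug_ker R.
apply: mono0 => x u; rewrite /= pair_comp => e.
have := congr1 (comp (pr1 _ _)) e; rewrite pr1_pair compm0 => /kR[w wE].
have := congr1 (comp (pr2 _ _)) e; rewrite pr2_pair compm0 -wE compA phiE.
by move=> /(mono_eq0 mI) ->; rewrite compm0.
Qed.

Lemma coneR_hom (k : nat) (f : hom M (coneR k.+1)) : coneR_dif k.+1 \o f = 0 ->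
  exists g, coneR_dif k \o g = f.
Proof.
apply: exact_homR; [exact: coneR_mono | exact: coneR_exact |].
case=> [|m]; first exact: (aY (cores_in R _)).
apply: acyc_bp2; first exact: (aY (cores_in R _)).
exact/acyc_inj/(cores_in I).
Qed.

(** Now [pairm x y] is a cycle with values in the cone; projecting a preimage to [R] gives [x']. *)
Lemma kappaAY_inj (i j l : int) : i = j + 1 -> l = j - 1 ->
  forall (x : hom M (R j)) (y : hom M (I i)), dif R j l \o x = 0 ->
  phi j \o x = dif I i j \o y -> exists x' : hom M (R i), dif R i j \o x' = x.
Proof.
move=> ei el x y; have [j0|j0] := boolP (0 < j).
  by exists 0; rewrite compm0; apply/esym/(cores_pos R _ _).2.
have [k ej] : exists k : nat, j = k%:C by exists `|j|%N; lia.
move: x; rewrite {}ej in ei el *; case: k ei el => [|k] ei el x x0 xy {j0}.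
  have x00 : x = 0.
    apply: (mono_eq0 coneR_mono); rewrite /= pair_comp xy.
    rewrite (_ : 1%:C = l); last by rewrite el.
    rewrite x0 (_ : y = 0) ?compm0 /pairm ?compm0 ?addr0 //.
    by apply: (cores_pos I _ _).2; lia.
  by exists 0; rewrite compm0 x00.
have ei' : i = k%:C by lia.
have el' : l = k.+2%:C by lia.
rewrite {}ei' {}el' in y x0 xy *.
have [|g gE] := @coneR_hom k (pairm x y).
  by rewrite /= pair_comp -compA pr1_pair copair_pair x0 compNl xy subrr /pairm !compm0 addr0.
by exists (coneR_pr k \o g); rewrite compA -coneR_pr1_dif -compA gE pr1_pair.
Qed.

(** A preimage of the cycle [pairm 0 y] has components [x] in [R] and [y'] in [I]. *)
Lemma kappaAY_surj (i j l : int) : i = j + 1 -> l = j - 1 ->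
  forall y : hom M (I j), dif I j l \o y = 0 ->
  exists (x : hom M (R j)) (y' : hom M (I i)),
    dif R j l \o x = 0 /\ phi j \o x = y + (dif I i j \o y').
Proof.
move=> ei el y; have [j0|j0] := boolP (0 < j).
  exists 0, 0; rewrite !compm0 addr0; split=> //.
  by apply/esym/(cores_pos I _ _).2.
have [k ej] : exists k : nat, j = k%:C by exists `|j|%N; lia.
move: y; rewrite {}ej in ei el *; have el' : l = k.+1%:C by lia.
rewrite {}el' => y y0.
have [|g gE] := @coneR_hom k (pairm 0 y).
  rewrite /= pair_comp -compA pr1_pair copair_pair !compm0 add0r compNl y0 oppr0.
  by rewrite /pairm !compm0 addr0.
have gR : dif R k%:C k.+1%:C \o (coneR_pr k \o g) = 0.
  by rewrite compA -coneR_pr1_dif -compA gE pr1_pair.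
have {gE} := congr1 (comp (pr2 _ _)) gE; rewrite pr2_pair => gE.
exists (coneR_pr k \o g).
case: k {j0 el} ei y y0 g gR gE => [|k] ei y y0 g gR /=; rewrite compA pr2_pair.
  by move=> gy; exists 0; split; [exact: gR | rewrite compm0 addr0 comp1m].
have ei' : i = k%:C by lia.
rewrite {}ei' => gy; exists (pr2 _ _ \o g); split=> //.
by rewrite -gy /copairm compDl compNl compNl -!compA subrK.
Qed.

Lemma kappaAY_bij n : bijective (kappaAY phi M n).
Proof.
apply: abHmap_bij => /= [x y|y]; rewrite /postcomp.
  by apply: kappaAY_inj; lia.
by apply: kappaAY_surj; lia.
Qed.

End ConeAY.

Theorem proposition4p11 (A : abelianCat) (W X V Y : A -> Prop)
    (subW : subcategory W) (subX : subcategory X)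
    (subV : subcategory V) (subY : subcategory Y)
    (WX : forall c : A, W c -> X c) (VY : forall c : A, V c -> Y c)
    (orthXW : Ext_orthogonal X W) (orthVY : Ext_orthogonal V Y) (M N : A) :
  (res_tilde X M -> res_tilde (@projective A) M -> res_hat W N ->
     forall (P : resolution (@projective A) M) (R : resolution X M),
     proper_resolution R ->
     forall phi : chain_map P R, lifts_id phi ->
     forall n : int, bijective (kappaXA phi N n)) /\
  (cores_hat V M -> cores_tilde Y N -> cores_tilde (@injective_ob A) N ->
     forall (R : coresolution Y N) (I : coresolution (@injective_ob A) N),
     proper_coresolution R ->
     forall phi : chain_map R I, extends_id phi ->
     forall n : int, bijective (kappaAY phi M n)).
Proof.
split=> [_ _ [S bS] P R _ phi phiE n|[S bS] _ _ R I _ phi phiE n].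
  (* Objects of [X] are acyclic for the terms of the resolution [S] of [N], hence for [N]. *)
  apply: kappaXA_bij => // c Xc; apply: (acyc_res_hat _ bS) => w Ww.
  exact: (orthogonal_acyc orthXW).
apply: kappaAY_bij => // c Yc; apply: (acyc_cores_hat _ bS) => v Vv.
exact: (orthogonal_acyc orthVY).
Qed.
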